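(* (1) Suppose $1<p\le 2$ and $\alpha\in(0,1/q)$, where $1/p+1/q=1$. Then there exists a bounded linear operator $u_p:\ell_1\to\ell_p$ such that, for every $n\in\mathbb{N}$, $$d_n^a(u_p)\le c_n(u_p)\le\beta_{p\alpha}(1+\log n)\,n^{-1/q}\quad\text{and}\quad d_n(u_p)\ge\gamma_{p\alpha}\,n^{-\alpha}.$$ (2) Suppose $2<p<\infty$ and $\alpha\in(0,1/p)$. Then there exists a bounded linear operator $u_p:\ell_1\to\ell_p$ such that, for every $n\in\mathbb{N}$, $$d_n^a(u_p)\le c_n(u_p)\le\beta_{p\alpha}(1+\log n)\,n^{-1/2}\quad\text{and}\quad d_n(u_p)\ge\gamma_{p\alpha}\,n^{1/p-1/2-\alpha}.$$ Here $\beta_{p\alpha}$ and $\gamma_{p\alpha}$ are positive constants depending on $p$ and $\alpha$ only.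
   Context: For a bounded subset $K$ of a Banach space $\mathcal{X}$ and an integer $n\ge 0$, $d_n(K,\mathcal{X})=\inf_{\mathcal{X}_n}\sup_{x\in K}\inf_{z\in\mathcal{X}_n}\|x-z\|$, the outer infimum being over all linear subspaces $\mathcal{X}_n\subset\mathcal{X}$ of dimension at most $n$ (Kolmogorov width). For a bounded $K$ in a Banach space $\mathcal{Y}$, $d_n^a(K)=\inf_{\mathcal{Z}}d_n(K,\mathcal{Z})$, the infimum being over all Banach spaces $\mathcal{Z}$ containing $\mathcal{Y}$ isometrically as a subspace (absolute width). For a bounded linear operator $T:\mathcal{X}\to\mathcal{Y}$ with $B(\mathcal{X})$ the closed unit ball of $\mathcal{X}$: $d_n(T)=d_n(\overline{T(B(\mathcal{X}))},\mathcal{Y})$, $d_n^a(T)=d_n^a(\overline{T(B(\mathcal{X}))})$, with $\overline{T(B(\mathcal{X}))}\subset\mathcal{Y}$. The Gelfand numbers are $c_n(T)=\inf\{\|T|_E\|: E\subset\mathcal{X}\text{ a closed subspace},\ \operatorname{codim}E\le n\}$. *)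

(* Defs.v *)
From HB Require Import structures.
From mathcomp Require Import all_boot all_order all_algebra.
From mathcomp Require Import all_classical all_reals all_analysis.

Set Implicit Arguments.
Unset Strict Implicit.
Unset Printing Implicit Defensive.

Import Order.TTheory GRing.Theory Num.Theory.
Import numFieldNormedType.Exports.

Local Open Scope classical_set_scope.
Local Open Scope ring_scope.

Section ell.
Context {R : realType}.

Definition counting_nat : {measure set nat -> \bar R} := @counting nat R.

Variables (p : R) (p1 : 1 <= p).

Let p1E : (1 <= p%:E)%E := p1.

(* No quotient by a.e. equality is needed for the counting measure: see [ellP]
   and [ell_norm0_eq0]. *)
Definition ell : Type := LfunType counting_nat p1E.

HB.instance Definition _ := GRing.Lmodule.on ell.

Definition ell_fun (x : ell) : nat -> R := x : LfunType counting_nat p1E.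
Coercion ell_fun : ell >-> Funclass.

Definition ell_norm (x : ell) : R := fine ('N[counting_nat]_p%:E[EFin \o x])%E.

Lemma ell_normD x y : ell_norm (x + y) <= ell_norm x + ell_norm y.
Proof. exact: ler_LnormD. Qed.

Lemma ell_normEFin (x : ell) :
  (ell_norm x)%:E = 'N[counting_nat]_p%:E[EFin \o x]%E.
Proof. exact: finite_norm_fine. Qed.

Lemma ell_normZ (a : R) x : ell_norm (a *: x) = `|a| * ell_norm x.
Proof.
by apply: EFin_inj; rewrite EFinM !ell_normEFin; exact: LnormZ.
Qed.

Let p0 : 0 < p. Proof. exact: lt_le_trans p1. Qed.

Lemma ell_normE (x : ell) :
  ((ell_norm x `^ p)%:E = \sum_(k <oo) (`|x k| `^ p)%:E)%E.
Proof.
rewrite -poweR_EFin ell_normEFin Lnorm_counting//.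
rewrite -poweRrM mulVf ?gt_eqF// poweRe1//.
by apply: (@nneseries_ge0 _ _ xpredT 0%N) => k _ _; exact: poweR_ge0.
Qed.

Lemma ell_norm_ge0 (x : ell) : 0 <= ell_norm x.
Proof. by rewrite -lee_fin ell_normEFin; exact: Lnorm_ge0. Qed.

Lemma ell_sum_le (x : ell) N :
  \sum_(k < N) `|x k| `^ p <= ell_norm x `^ p.
Proof.
rewrite -lee_fin ell_normE -sumEFin -(big_mkord xpredT (fun k => (`|x k| `^ p)%:E)).
by apply: nneseries_lim_ge => k _ _; rewrite lee_fin powR_ge0.
Qed.

Lemma ell_coord_le (x : ell) k : `|x k| <= ell_norm x.
Proof.
rewrite leNgt; apply/negP => xk.
have := ell_sum_le x k.+1; rewrite leNgt => /negP; apply.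
rewrite big_ord_recr/= ltr_wpDl//; first by apply: sumr_ge0 => i _; exact: powR_ge0.
by apply: gt0_ltr_powR; rewrite ?nnegrE ?ell_norm_ge0.
Qed.

Lemma ellP (x y : ell) : x =1 y -> x = y.
Proof. by move=> xy; exact/LfuneqP. Qed.

Lemma ell_norm0_eq0 (x : ell) : ell_norm x = 0 -> x = 0.
Proof.
move=> x0; apply: ellP => k; have := ell_coord_le x k.
by rewrite x0 normr_le0 => /eqP.
Qed.

HB.instance Definition _ :=
  @Lmodule_isNormed.Build R ell ell_norm ell_normD ell_normZ ell_norm0_eq0.


Lemma ell_mem (f : nat -> R) :
  (\sum_(k <oo) (`|f k| `^ p)%:E < +oo)%E -> f \in Lfun counting_nat p%:E.
Proof.
move=> fp; rewrite inE; apply/andP; split; first by rewrite inE /= => _ Y _.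
rewrite inE/= /finite_norm Lnorm_counting//; exact: poweR_lty.
Qed.

Definition ell_of (f : nat -> R)
    (fp : (\sum_(k <oo) (`|f k| `^ p)%:E < +oo)%E) : ell :=
  Lfun_Sub p1E (ell_mem fp).

Lemma ell_ofE f fp : @ell_of f fp =1 f. Proof. by []. Qed.

Lemma continuous_norm_powR : continuous (fun t : R => `|t| `^ p).
Proof.
move=> t; have [->|t0] := eqVneq t 0.
  rewrite /continuous_at normr0 powR0 ?gt_eqF//.
  apply/cvgrPdist_lt => e e0; near=> s.
  rewrite sub0r normrN ger0_norm ?powR_ge0//.
  have [->|s0] := eqVneq s 0; first by rewrite normr0 powR0 ?gt_eqF.
  apply: (@le_lt_trans _ _ `|s|).
    apply: ge1r_powR => //; rewrite normr_gt0 s0/=; near: s.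
    by apply: (@cvgr0_norm_le _ _ _ _ _ id) => //; exact: cvg_id.
  near: s; apply: (@cvgr0_norm_lt _ _ _ _ _ id) => //; exact: cvg_id.
apply: (@cvg_comp _ _ _ (fun s : R => `|s|) (@powR R ^~ p) _ (nbhs `|t|)).
  exact: norm_continuous.
apply: (differentiable_continuous (f := @powR R ^~ p)); apply/derivable1_diffP.
by apply: derivable_powR; rewrite in_itv/= andbT normr_gt0.
Unshelve. all: by end_near. Qed.

Lemma ell_complete (F : set_system ell) : ProperFilter F -> cauchy F -> cvg F.
Proof.
move=> FF /cauchy_ballP cF.
have coord k : cvg ((fun x : ell => x k) @ F).
  apply: cauchy_cvg; apply/cauchy_ballP => e e0.
  have := cF e e0; rewrite !near2E /= => -[[A B]/= [FA FB] AB].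
  exists ((fun x : ell => x k) @` A, (fun x : ell => x k) @` B) => /=.
    by split; [apply: filterS FA|apply: filterS FB] => x Ax; exists x.
  move=> _ [[x Ax] <- [y By] <-].
  have /= := AB (x, y) (conj Ax By).
  rewrite -!ball_normE/=; apply: le_lt_trans; exact: (ell_coord_le (x - y)).
pose l k : R := lim ((fun x : ell => x k) @ F).
have key e (y : ell) : 0 < e -> F [set x | `|x - y| <= e] ->
    forall N, \sum_(k < N) `|l k - y k| `^ p <= e `^ p.
  move=> e0 Fy N.
  have cv : (fun x : ell => \sum_(k < N) `|x k - y k| `^ p) @ F -->
      \sum_(k < N) `|l k - y k| `^ p.
    apply: cvg_big => [|k _]; first exact: add_continuous.
    apply: (@cvg_comp _ _ _ (fun x : ell => x k - y k)
      (fun t : R => `|t| `^ p) _ (nbhs (l k - y k))).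
      by apply: cvgB; [exact: coord|exact: cvg_cst].
    exact: continuous_norm_powR.
  apply: (cvgr_to_le cv); apply: filterS Fy => x /= xy.
  apply: le_trans (ell_sum_le (x - y) N) _.
  by apply: ge0_ler_powR; rewrite ?nnegrE ?ell_norm_ge0 ?(ltW p0) ?(ltW e0).
have key2 e (y : ell) : 0 < e -> F [set x | `|x - y| <= e] ->
    (\sum_(k <oo) (`|l k - y k| `^ p)%:E <= (e `^ p)%:E)%E.
  move=> e0 Fy; apply: lime_le.
    by apply: is_cvg_nneseries => k _ _; rewrite lee_fin powR_ge0.
  apply: nearW => N; rewrite sumEFin lee_fin big_mkord; exact: key.
have near_y e : 0 < e -> \forall y \near F, F [set x : ell | `|x - y| <= e].
  move=> e0; have := cF e e0; rewrite near2E /= => -[[A B]/= [FA FB] AB].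
  apply: filterS FB => y By; apply: filterS FA => x Ax /=.
  have /= := AB (x, y) (conj Ax By).
  by rewrite -ball_normE/= => /ltW.
have [y0 Fy0] := filter_ex (near_y 1 ltr01).
have ly0 := le_lt_trans (key2 1 y0 ltr01 Fy0) (ltry _).
pose L : ell := ell_of ly0 + y0.
have LE k : L k = l k by rewrite /L -[LHS]/(l k - y0 k + y0 k) subrK.
apply/cvg_ex; exists L; apply/cvgrPdist_le => e e0.
apply: filterS (near_y e e0) => y Fy.
have := key2 e y e0 Fy.
rewrite (_ : (\sum_(k <oo) _)%E = (`|L - y| `^ p)%:E); last first.
  by rewrite ell_normE; apply: eq_eseriesr => k _; rewrite -LE.
rewrite lee_fin => h; rewrite leNgt; apply/negP => eL.
move: h; rewrite leNgt => /negP; apply.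
by apply: gt0_ltr_powR; rewrite ?nnegrE ?ell_norm_ge0 ?ltW.
Qed.

HB.instance Definition _ := Uniform_isComplete.Build ell ell_complete.

Lemma normr_ellE (x : ell) :
  ((`|x| `^ p)%:E = \sum_(k <oo) (`|x k| `^ p)%:E)%E.
Proof. exact: ell_normE. Qed.

Lemma ellDE (x y : ell) k : (x + y) k = x k + y k. Proof. by []. Qed.

Lemma ellZE (a : R) (x : ell) k : (a *: x) k = a * x k. Proof. by []. Qed.

End ell.

Lemma gt2_ge1 (R : realType) (p : R) : 2 < p -> 1 <= p.
Proof. by move=> /ltW; apply: le_trans; rewrite ler1n. Qed.

Section linear_dimension.
Context {R : realType} {X : lmodType R}.
Implicit Types (V E : set X) (m n : nat).

Definition linear_subspace V : Prop :=
  V 0 /\ forall (a : R) (x y : X), V x -> V y -> V (a *: x + y).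

Definition lincomb m (v : 'I_m -> X) (a : 'I_m -> R) : X :=
  \sum_(i < m) a i *: v i.

Definition has_dim V m : Prop :=
  exists v : 'I_m -> X, range (lincomb v) = V /\
    forall a, lincomb v a = 0 -> forall i, a i = 0.

Definition dim_le V n : Prop := exists2 m, (m <= n)%N & has_dim V m.

(* the classes of the [v i] form a basis of the quotient space [X / E] *)
Definition has_codim E m : Prop :=
  exists v : 'I_m -> X, (forall x, exists a, E (x - lincomb v a)) /\
    forall a, E (lincomb v a) -> forall i, a i = 0.

Definition codim_le E n : Prop := exists2 m, (m <= n)%N & has_codim E m.

End linear_dimension.

(* All widths are extended reals, so that the infima and suprema below need no
   side conditions; on the bounded sets considered here they are finite. *)
Section widths.
Context {R : realType}.
Local Open Scope ereal_scope.

Definition kolmogorov_width (n : nat) (X : completeNormedModType R)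
    (K : set X) : \bar R :=
  ereal_inf [set ereal_sup [set ereal_inf [set `|x - z|%:E | z in V] | x in K]
            | V in [set V : set X | linear_subspace V /\ dim_le V n]].

(* A Banach space containing [Y] isometrically as a subspace is a Banach space
   [Z] with a linear isometric embedding [j : Y -> Z]. *)
Definition absolute_width (n : nat) (Y : completeNormedModType R)
    (K : set Y) : \bar R :=
  ereal_inf [set d | exists (Z : completeNormedModType R) (j : {linear Y -> Z}),
    (forall y : Y, `|j y| = `|y|)%R /\ d = kolmogorov_width n (j @` K)].

Definition closed_unit_ball (X : completeNormedModType R) : set X :=
  [set x | `|x| <= 1]%R.

Section operators.
Context {X Y : completeNormedModType R}.
Implicit Types T : {linear X -> Y}.

Definition bounded_operator T : Prop :=
  exists M : R, forall x, (`|T x| <= M * `|x|)%R.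

Definition op_kolmogorov_width (n : nat) T : \bar R :=
  kolmogorov_width n (closure (T @` @closed_unit_ball X)).

Definition op_absolute_width (n : nat) T : \bar R :=
  absolute_width n (closure (T @` @closed_unit_ball X)).

Definition restricted_norm T (E : set X) : \bar R :=
  ereal_sup [set `|T x|%:E | x in E `&` @closed_unit_ball X].

Definition gelfand_number (n : nat) T : \bar R :=
  ereal_inf [set restricted_norm T E | E in
    [set E : set X | [/\ linear_subspace E, closed E & codim_le E n]]].

End operators.
End widths.

(* Main.v *)
Require Import Defs.
From HB Require Import structures.
From mathcomp Require Import all_boot all_order all_algebra.
From mathcomp Require Import all_classical all_reals all_analysis.
From mathcomp Require Import ring lra.

(* The operator is the diagonal map [x |-> ((k+1)^-alpha x_k)_k].

   Gelfand numbers.  For [n] rows of signs such that the matrix [A] they form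
   satisfies [|A y|^2 >= n/2 |y|^2] for all [y = sum_(l < m) +-e_(i_l)],
   [i_l < M], Maurey's empirical method gives [|x|_2 <= |x|_1 / sqrt (m - 1)] on
   the kernel of [A]; a fourth-moment lower-tail bound shows that such rows exist
   with [m] of order [n / ln M].  Taking [M] to be a power of [n] so large that
   the diagonal entries beyond [M] are negligible, and comparing the lp norm with
   the l1 and l2 norms, bounds the Gelfand numbers.

   Absolute widths.  Embed [Y] into the bounded functions on its dual ball and
   extend [T|_E] there coordinatewise by Hahn-Banach: the difference between [T]
   and the extension has rank at most [codim E].

   Kolmogorov widths.  A subspace of dimension [n] has an orthonormal family of
   [n] vectors orthogonal to it in [R^(2n)], so on average the first [2n] basis
   vectors are at Euclidean distance at least [1/sqrt 2] from it. *)

Set Implicit Arguments.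
Unset Strict Implicit.
Unset Printing Implicit Defensive.

Import Order.TTheory GRing.Theory Num.Theory.
Import numFieldNormedType.Exports.

Local Open Scope classical_set_scope.
Local Open Scope ring_scope.

(** * Codimension, linear dependence and rank *)

Section codimension.
Context {R : realType} {X : lmodType R}.
Implicit Types (E K : set X).

Lemma linear_subspace_lincomb K m (v : 'I_m -> X) (a : 'I_m -> R) :
  linear_subspace K -> (forall i, K (v i)) -> K (lincomb v a).
Proof.
move=> [K0 KL] Kv; apply: (big_ind K) => [//|x y Kx Ky|i _].
  by rewrite -[x]scale1r; exact: KL.
by rewrite -[_ *: _]addr0; exact: KL.
Qed.

Lemma lincomb_recl m (v : 'I_m.+1 -> X) (a : 'I_m.+1 -> R) :
  lincomb v a = a ord0 *: v ord0 +
    lincomb (fun i => v (lift ord0 i)) (fun i => a (lift ord0 i)).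
Proof. exact: big_ord_recl. Qed.

(** A maximal family independent modulo [K] is a basis of the quotient. Its size [m] is one less
    than the smallest size for which no independent family exists, and the hypothesis keeps that
    size at most [n + 1]. *)
Lemma codim_le_dependent K n : linear_subspace K ->
  (forall x : 'I_n.+1 -> X, exists a, K (lincomb x a) /\ exists i, a i != 0) ->
  codim_le K n.
Proof.
move=> KS dep.
pose indep m := exists v : 'I_m -> X, forall a, K (lincomb v a) -> forall i, a i = 0.
have ex : exists k, ~~ `[< indep k >].
  exists n.+1; apply/asboolP => -[v vP].
  by have [a [/vP a0 [i]]] := dep v; rewrite a0 eqxx.
case: (ex_minnP ex) => -[|m] /asboolP Nm minm.
  by exfalso; apply: Nm; exists (fun=> 0) => a _ [].
have mn : (m <= n)%N.
  have := minm n.+1; rewrite ltnS; apply; apply/asboolP => -[v vP].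
  by have [a [/vP a0 [i]]] := dep v; rewrite a0 eqxx.
have [v vP] : indep m.
  by apply/asboolP; apply: contraT => /minm; rewrite ltnn.
exists m => //; exists v; split=> // x.
(* With [x] put in front of [v] the family becomes dependent modulo [K]. Since [v] is independent,
   the coefficient of [x] in the relation is nonzero, so the relation can be solved for [x]. *)
pose w (i : 'I_m.+1) := if unlift ord0 i is Some j then v j else x.
have wE a : lincomb w a = a ord0 *: x + lincomb v (fun i => a (lift ord0 i)).
  rewrite lincomb_recl /w unlift_none; congr (_ + _).
  by rewrite /lincomb; apply: eq_bigr => i _; rewrite liftK.
have [a [Ka [i ai0]]] : exists a, K (lincomb w a) /\ exists i, a i != 0.
  apply: contrapT => H; apply: Nm; exists w => a Ka i.
  by apply/eqP/negPn/negP => ai; apply: H; exists a; split => //; exists i.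
have a0 : a ord0 != 0.
  apply: contra_neq ai0 => a0; move: Ka; rewrite wE a0 scale0r add0r => /vP h.
  by case: (unliftP ord0 i) => [j|] ->; rewrite ?h.
exists (fun i => - (a ord0)^-1 * a (lift ord0 i)).
have -> : x - lincomb v (fun i0 => - (a ord0)^-1 * a (lift ord0 i0)) =
    (a ord0)^-1 *: lincomb w a + 0.
  rewrite wE scalerDr scalerA mulVf// scale1r addr0; congr (_ + _).
  rewrite /lincomb scaler_sumr -sumrN; apply: eq_bigr => j _.
  by rewrite scalerA -scaleNr mulNr opprK.
by apply: KS.2 => //; exact: KS.1.
Qed.

Lemma underdetermined_system n (A : 'I_n.+1 -> 'I_n -> R) :
  exists c : 'I_n.+1 -> R, (forall j, \sum_i c i * A i j = 0) /\
    exists i, c i != 0.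
Proof.
pose M : 'M[R]_(n.+1, n) := \matrix_(i, j) A i j.
have : kermx M != 0.
  by rewrite -mxrank_eq0 mxrank_ker subn_eq0 -ltnNge ltnS rank_leq_col.
move=> /rowV0Pn[u /sub_kermxP uM u0]; exists (fun i => u 0 i); split.
  move=> j; move/matrixP: uM => /(_ 0 j); rewrite !mxE => uM0; rewrite -[RHS]uM0.
  by apply: eq_bigr => i _; rewrite mxE.
apply: contrapT => H; case/eqP: u0; apply/rowP => i; rewrite mxE.
by apply/eqP/negPn/negP => ui; apply: H; exists i.
Qed.

(** The coefficient vectors of [n + 1] points lie in [R^n], so they satisfy a nontrivial relation;
    the same relation takes the points themselves into [K]. *)
Lemma codim_le_spanning K n (v : 'I_n -> X) : linear_subspace K ->
  (forall x, exists a, K (x - lincomb v a)) -> codim_le K n.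
Proof.
move=> KS /choice[A AP]; apply: codim_le_dependent => // x.
have [c [cA cN0]] := underdetermined_system (fun i => A (x i)).
exists c; split => //.
have -> : lincomb x c = lincomb (fun i => x i - lincomb v (A (x i))) c.
  rewrite /lincomb; under [RHS]eq_bigr do rewrite scalerBr scaler_sumr.
  rewrite sumrB exchange_big /= [X in _ - X]big1 ?subr0// => j _.
  by under eq_bigr do rewrite scalerA; rewrite -scaler_suml cA scale0r.
by apply: linear_subspace_lincomb => // i; exact: AP.
Qed.

Lemma linear_lincomb (Z : lmodType R) (phi : X -> Z) m (v : 'I_m -> X) a :
  (forall b x y, phi (b *: x + y) = b *: phi x + phi y) ->
  phi (lincomb v a) = lincomb (phi \o v) a.
Proof.
move=> L; have L0 : phi 0 = 0.
  have := L 1 0 0; rewrite !scale1r addr0.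
  by move=> /eqP; rewrite -subr_eq subrr => /eqP.
rewrite /lincomb; elim/big_ind2 : _ => // [x1 y1 x2 y2 <- <-|i _].
  by have := L 1 y1 y2; rewrite !scale1r.
by have := L (a i) (v i) 0; rewrite !addr0 L0 addr0.
Qed.

Lemma codim_le_functionals n (phi : 'I_n -> X -> R) :
  (forall r b x y, phi r (b *: x + y) = b * phi r x + phi r y) ->
  codim_le [set x | forall r, phi r x = 0] n.
Proof.
move=> L.
have L0 r : phi r 0 = 0.
  have := L r 1 0 0; rewrite scale1r mul1r addr0.
  by move=> /eqP; rewrite -subr_eq subrr => /eqP.
apply: codim_le_dependent => [|x].
  by split=> [//|a x y /= x0 y0 r]; rewrite L x0 y0 mulr0 addr0.
have [c [cA cN0]] := underdetermined_system (fun i r => phi r (x i)).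
exists c; split => // r /=.
rewrite (@linear_lincomb (R^o : lmodType R) (phi r))//.
exact: cA.
Qed.

(** The range is isomorphic to the quotient by the kernel. A basis modulo [E] still spans modulo the
    larger kernel but may become dependent there, hence the passage through [codim_le_spanning]. *)
Lemma dim_le_range (Z : lmodType R) (phi : X -> Z) E n :
  (forall b x y, phi (b *: x + y) = b *: phi x + phi y) ->
  (forall x, E x -> phi x = 0) -> codim_le E n -> dim_le (range phi) n.
Proof.
move=> L phiE [m mn [v [vs _]]].
have L0 : phi 0 = 0.
  have := L 1 0 0; rewrite !scale1r addr0.
  by move=> /eqP; rewrite -subr_eq subrr => /eqP.
pose K := [set x | phi x = 0].
have [|x|k km [w [ws wi]]] := @codim_le_spanning K m v.
- by split=> [//|a x y /= x0 y0]; rewrite /K/= L x0 y0 scaler0 addr0.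
- by have [a /phiE Ea] := vs x; exists a.
- exists k; first exact: leq_trans km mn.
  exists (phi \o w); split; last first.
    by move=> a; rewrite -linear_lincomb// => /wi.
  apply/seteqP; split=> [_ [a _ <-]|_ [x _ <-]].
    by exists (lincomb w a) => //; exact: linear_lincomb.
  have [a Ka] := ws x; exists a => //; rewrite -linear_lincomb//.
  have := L 1 (x - lincomb w a) (lincomb w a).
  by rewrite !scale1r subrK Ka add0r.
Qed.

End codimension.

(** * The Hahn-Banach theorem for a sublinear functional *)

Section hahn_banach.
Context {R : realType} {X : lmodType R}.
Variables (q : X -> R).
Hypothesis qD : forall x y, q (x + y) <= q x + q y.
Hypothesis qZ : forall a x, 0 <= a -> q (a *: x) = a * q x.
Implicit Types G H : set (X * R).

(** A partial linear functional is encoded by its graph, so that extension is inclusion and the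
    upper bound of a chain is a union. Domination makes the graph single-valued: two values over one
    point differ by a value over [0], which is at most [q 0 = 0]. *)
Definition dominated_graph G : Prop :=
  [/\ G (0, 0), (forall a x r y s, G (x, r) -> G (y, s) ->
        G (a *: x + y, a * r + s)) & forall x r, G (x, r) -> r <= q x].

Let q0 : q 0 = 0.
Proof. by have := @qZ 0 0 (lexx 0); rewrite scale0r mul0r. Qed.

(** The value at [x0] has to lie above all [r - q (x - x0)] and below all [q (x + x0) - r].
    Subadditivity puts every lower bound below every upper one, and the supremum [r0] of the lower
    bounds is taken. *)
Lemma dominated_graph_extend G x0 : dominated_graph G ->
  exists H, [/\ dominated_graph H, G `<=` H & exists r, H (x0, r)].
Proof.
move=> [G0 GL Gq].
pose S := [set u.2 - q (u.1 - x0) | u in G].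
have ub u w : G u -> G w -> u.2 - q (u.1 - x0) <= q (w.1 + x0) - w.2.
  move: u w => [x r] [y s] /= Gx Gy.
  have := Gq _ _ (GL 1 _ _ _ _ Gx Gy); rewrite scale1r mul1r => h.
  have := qD (x - x0) (y + x0); rewrite addrACA addNr addr0; lra.
have S0 : S !=set0 by exists (0 - q (0 - x0)); exists (0, 0).
have Sb : has_sup S.
  by split=> //; exists (q (0 + x0) - 0) => _ [u Gu <-]; exact: (ub u (0, 0)).
pose r0 := sup S.
have r1 x r : G (x, r) -> r - q (x - x0) <= r0.
  by move=> Gx; apply: (ub_le_sup Sb.2); exists (x, r).
have r2 x r : G (x, r) -> r0 <= q (x + x0) - r.
  by move=> Gx; apply: (ge_sup S0) => _ [u Gu <-]; exact: (ub u (x, r)).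
have GZ a x r : G (x, r) -> G (a *: x, a * r).
  by move=> Gx; have := GL a _ _ _ _ Gx G0; rewrite !addr0.
pose H := [set u | exists x r a, G (x, r) /\ u = (x + a *: x0, r + a * r0)].
exists H; split.
- split.
  + by exists 0, 0, 0; rewrite scale0r mul0r !addr0.
  + move=> a _ _ _ _ [x [r [b [Gx [-> ->]]]]] [y [s [c [Gy [-> ->]]]]].
    exists (a *: x + y), (a * r + s), (a * b + c); split; first exact: GL.
    congr (_, _); last by ring.
    by rewrite scalerDr scalerA addrACA scalerDl.
  + move=> _ _ [x [r [a [Gx [-> ->]]]]].
    have [a0|a0|->] := ltgtP a 0; last first.
    * by rewrite scale0r mul0r !addr0; exact: Gq.
    * have := r2 _ _ (GZ a^-1 _ _ Gx).
      have -> : q (x + a *: x0) = a * q (a^-1 *: x + x0).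
        by rewrite -qZ ?(ltW a0)// scalerDr scalerA divff ?gt_eqF// scale1r.
      rewrite -(ler_pM2l a0) mulrBr mulrA divff ?gt_eqF// mul1r; lra.
    * have a0' : 0 < - a by rewrite oppr_gt0.
      have := r1 _ _ (GZ (- a)^-1 _ _ Gx).
      have -> : q (x + a *: x0) = - a * q ((- a)^-1 *: x - x0).
        rewrite -qZ ?(ltW a0')// scalerBr scalerA divff ?gt_eqF// scale1r.
        by rewrite scaleNr opprK.
      rewrite -(ler_pM2l a0') mulrBr mulrA divff ?gt_eqF// mul1r; lra.
- by move=> [x r] Gx; exists x, r, 0; rewrite scale0r mul0r !addr0.
- by exists r0, 0, 0, 1; rewrite scale1r mul1r !add0r.
Qed.

Lemma hahn_banach (E : set X) (f : X -> R) : linear_subspace E ->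
  (forall a x y, E x -> E y -> f (a *: x + y) = a * f x + f y) ->
  (forall x, E x -> f x <= q x) ->
  exists g : X -> R, [/\ forall a x y, g (a *: x + y) = a * g x + g y,
    forall x, g x <= q x & forall x, E x -> g x = f x].
Proof.
move=> [E0 EL] fL fq.
pose G0 : set (X * R) := [set u | E u.1 /\ u.2 = f u.1].
have f0 : f 0 = 0.
  have := fL 1 0 0 E0 E0; rewrite scale1r mul1r addr0.
  by move=> /eqP; rewrite -subr_eq subrr => /eqP.
have G0d : dominated_graph G0.
  split=> [|a x r y s [/= Ex ->] [/= Ey ->]|x r [/= Ex ->]]; last exact: fq.
  - by rewrite /G0/= f0.
  - by split=> /=; [exact: EL|rewrite fL].
(* Joining [G0] to every set makes the empty chain admissible and forces the maximal graph to extend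
   [f]. *)
have [F FP Ftot|A [Ad Amax]] :=
    @Zorn_bigcup _ [set G | dominated_graph (G `|` G0)].
  pose U := \bigcup_(G in F) G `|` G0.
  have two u w : U u -> U w ->
      exists H, [/\ dominated_graph H, H u, H w & H `<=` U].
    have sub G : F G -> G `|` G0 `<=` U.
      by move=> FG; apply: setSU; exact: bigcup_sup.
    move=> [[G1 F1 G1u]|G0u] [[G2 F2 G2w]|G0w].
    - have [s|s] := Ftot _ _ F1 F2.
      + exists (G2 `|` G0); split; [exact: FP|by left; exact: s|by left|exact: sub].
      + exists (G1 `|` G0); split; [exact: FP|by left|by left; exact: s|exact: sub].
    - by exists (G1 `|` G0); split; [exact: FP|left|right|exact: sub].
    - by exists (G2 `|` G0); split; [exact: FP|right|left|exact: sub].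
    - by exists G0; split=> //; exact: subsetUr.
  split.
  - by right; case: G0d.
  - move=> a x r y s Ux Uy; have [H [[_ HL _] Hx Hy HU]] := two _ _ Ux Uy.
    by apply: HU; exact: HL.
  - move=> x r Ux; have [H [[_ _ Hq] Hx _ _]] := two _ _ Ux Ux.
    exact: Hq.
have tot x : exists r, (A `|` G0) (x, r).
  have [H [Hd AH [r Hr]]] := dominated_graph_extend x Ad.
  exists r; apply: contrapT => NA; apply: (Amax H).
    split; first by move=> u Au; apply: AH; left.
    by move=> /(_ _ Hr) ?; apply: NA; left.
  by rewrite /= setUidl// => u G0u; apply: AH; right.
have [_ AL Aq] := Ad.
have uniq x r s : (A `|` G0) (x, r) -> (A `|` G0) (x, s) -> r <= s.
  move=> Ar As; have := Aq _ _ (AL (-1) _ _ _ _ As Ar).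
  by rewrite scaleN1r addNr q0; lra.
have uniq' x r s : (A `|` G0) (x, r) -> (A `|` G0) (x, s) -> r = s.
  by move=> Ar As; apply/eqP; rewrite eq_le !(uniq x).
have [g gA] := choice tot.
exists g; split=> [a x y|x|x Ex].
- by apply: (uniq' (a *: x + y)) => //; exact: AL.
- exact: Aq.
- by apply: (uniq' x) => //; right.
Qed.

End hahn_banach.

(** * The Banach space of bounded functions with the supremum norm *)

Section bounded_functions.
Context {R : realType} (I : Type).

Definition bounded_funs : {pred I -> R} :=
  fun f => `[< exists M, forall i, `|f i| <= M >].

Record bfun := BFun { bfun_val :> I -> R; bfun_valP : bfun_val \in bounded_funs }.

HB.instance Definition _ := [isSub for bfun_val].
HB.instance Definition _ := [Choice of bfun by <:].

Lemma bounded_funs_submod : submod_closed bounded_funs.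
Proof.
split=> [|a f g /asboolP[M fM] /asboolP[N gN]]; apply/asboolP.
  by exists 0 => i; rewrite normr0.
exists (`|a| * M + N) => i.
by rewrite (le_trans (ler_normD _ _))// lerD// normrM ler_wpM2l.
Qed.

HB.instance Definition _ := GRing.isSubmodClosed.Build _ _ bounded_funs
  bounded_funs_submod.
HB.instance Definition _ := [SubChoice_isSubLmodule of bfun by <:].

(** The value [0] keeps the set nonempty when the index type [I] is empty. *)
Definition bfun_norm (f : bfun) : R := sup [set r | r = 0 \/ exists i, r = `|f i|].

Lemma bfun_has_sup (f : bfun) : has_sup [set r | r = 0 \/ exists i, r = `|f i|].
Proof.
split; first by exists 0; left.
have /asboolP[M fM] := bfun_valP f.
exists `|M| => _ [->|[i ->]]//; exact: le_trans (fM i) (ler_norm _).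
Qed.

Lemma bfun_norm_ge0 (f : bfun) : 0 <= bfun_norm f.
Proof. by apply: (ub_le_sup (bfun_has_sup f).2); left. Qed.

Lemma bfun_le_norm (f : bfun) i : `|f i| <= bfun_norm f.
Proof. by apply: (ub_le_sup (bfun_has_sup f).2); right; exists i. Qed.

Lemma bfun_norm_le (f : bfun) C : 0 <= C -> (forall i, `|f i| <= C) ->
  bfun_norm f <= C.
Proof. by move=> C0 fC; apply: (ge_sup (bfun_has_sup f).1) => _ [->|[i ->]]. Qed.

Lemma bfunDE (f g : bfun) i : (f + g) i = f i + g i. Proof. by []. Qed.

Lemma bfunZE a (f : bfun) i : (a *: f) i = a * f i. Proof. by []. Qed.

Lemma bfunP (f g : bfun) : f =1 g -> f = g.
Proof. by move=> fg; apply/val_inj/funext. Qed.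

Lemma bfun_normD f g : bfun_norm (f + g) <= bfun_norm f + bfun_norm g.
Proof.
apply: bfun_norm_le => [|i]; first by rewrite addr_ge0 ?bfun_norm_ge0.
by rewrite bfunDE (le_trans (ler_normD _ _))// lerD ?bfun_le_norm.
Qed.

Lemma bfun_normZ_le a f : bfun_norm (a *: f) <= `|a| * bfun_norm f.
Proof.
apply: bfun_norm_le => [|i]; first by rewrite mulr_ge0 ?bfun_norm_ge0.
by rewrite bfunZE normrM ler_wpM2l ?bfun_le_norm.
Qed.

Lemma bfun_normZ a f : bfun_norm (a *: f) = `|a| * bfun_norm f.
Proof.
apply/eqP; rewrite eq_le bfun_normZ_le /=.
have [->|a0] := eqVneq a 0; first by rewrite normr0 mul0r bfun_norm_ge0.
rewrite -ler_pdivlMl ?normr_gt0// -normfV.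
by apply: le_trans (bfun_normZ_le _ _); rewrite scalerA mulVf// scale1r.
Qed.

Lemma bfun_norm0_eq0 f : bfun_norm f = 0 -> f = 0.
Proof.
move=> f0; apply: bfunP => i; have := bfun_le_norm f i.
by rewrite f0 normr_le0 => /eqP.
Qed.

HB.instance Definition _ :=
  @Lmodule_isNormed.Build R bfun bfun_norm bfun_normD bfun_normZ bfun_norm0_eq0.

(** The limit [l] is taken pointwise. A bound on [|f - g|] valid along [F] passes to [l] at every
    point with the same constant, so the convergence is uniform. *)
Lemma bfun_complete (F : set_system bfun) : ProperFilter F -> cauchy F -> cvg F.
Proof.
move=> FF /cauchy_ballP cF.
have coord i : cvg ((fun f : bfun => f i) @ F).
  apply: cauchy_cvg; apply/cauchy_ballP => e e0.
  have := cF e e0; rewrite !near2E /= => -[[A B]/= [FA FB] AB].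
  exists ((fun f : bfun => f i) @` A, (fun f : bfun => f i) @` B) => /=.
    by split; [apply: filterS FA|apply: filterS FB] => f Af; exists f.
  move=> _ [[f Af] <- [g Bg] <-].
  have /= := AB (f, g) (conj Af Bg).
  rewrite -!ball_normE/=; apply: le_lt_trans; exact: (bfun_le_norm (f - g)).
pose l i : R := lim ((fun f : bfun => f i) @ F).
have key e (g : bfun) : F [set f | `|f - g| <= e] -> forall i, `|l i - g i| <= e.
  move=> Fg i.
  have cv : (fun f : bfun => `|f i - g i|) @ F --> `|l i - g i|.
    by apply: cvg_norm; apply: cvgB; [exact: coord|exact: cvg_cst].
  apply: (cvgr_to_le cv); apply: filterS Fg => f /= fg.
  exact: le_trans (bfun_le_norm (f - g) i) fg.
have near_g e : 0 < e -> \forall g \near F, F [set f : bfun | `|f - g| <= e].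
  move=> e0; have := cF e e0; rewrite near2E /= => -[[A B]/= [FA FB] AB].
  apply: filterS FB => g Bg; apply: filterS FA => f Af /=.
  have /= := AB (f, g) (conj Af Bg).
  by rewrite -ball_normE/= => /ltW.
have [g0 Fg0] := filter_ex (near_g 1 ltr01).
have lb : l \in bounded_funs.
  have /asboolP[M g0M] := bfun_valP g0; apply/asboolP; exists (1 + M) => i.
  rewrite -(subrK (g0 i) (l i)) (le_trans (ler_normD _ _))// lerD//.
  exact: key.
apply/cvg_ex; exists (BFun lb); apply/cvgrPdist_le => e e0.
apply: filterS (near_g e e0) => g Fg.
by apply: bfun_norm_le => [|i]; [exact: ltW|exact: key].
Qed.

HB.instance Definition _ := Uniform_isComplete.Build bfun bfun_complete.

End bounded_functions.

(** * Absolute widths are bounded by Gelfand numbers *)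

Section absolute_le_gelfand.
Context {R : realType}.

Definition dual_ball (Y : completeNormedModType R) : set (Y -> R) :=
  [set f | (forall a x y, f (a *: x + y) = a * f x + f y) /\
           forall x, `|f x| <= `|x|].

Definition evaluation_fun (Y : completeNormedModType R) (y : Y)
  (f : {f : Y -> R | dual_ball f}) : R := sval f y.

Lemma evaluation_bounded (Y : completeNormedModType R) (y : Y) :
  evaluation_fun y \in @bounded_funs R {f : Y -> R | dual_ball f}.
Proof. by apply/asboolP; exists `|y| => -[f [fL fy]]; exact: fy. Qed.

Definition evaluation (Y : completeNormedModType R) (y : Y) :
  bfun {f : Y -> R | dual_ball f} := BFun (evaluation_bounded y).

Lemma evaluation_linear (Y : completeNormedModType R) : linear (@evaluation Y).
Proof. by move=> a x y; apply: bfunP => -[f [fL fy]]; exact: fL. Qed.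

HB.instance Definition _ (Y : completeNormedModType R) :=
  GRing.isLinear.Build R Y (bfun {f : Y -> R | dual_ball f}) _ (@evaluation Y)
    (@evaluation_linear Y).

Lemma linear_le_norm (X : lmodType R) (q g : X -> R) :
  (forall a x y, g (a *: x + y) = a * g x + g y) ->
  (forall x, q (- x) = q x) -> (forall x, g x <= q x) -> forall x, `|g x| <= q x.
Proof.
move=> gL qN gq x; rewrite ler_norml gq andbT lerNl.
have g0 : g 0 = 0.
  have := gL 1 0 0; rewrite scale1r mul1r addr0.
  by move=> /eqP; rewrite -subr_eq subrr => /eqP.
have := gL (-1) x 0; rewrite scaleN1r mulN1r !addr0 g0 addr0 => <-.
by rewrite -(qN x).
Qed.

(** Hahn-Banach extends the functional [a *: y |-> a * |y|] from the line spanned by [y]; [coef]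
    reads off [a] on that line. *)
Lemma norming_functional (Y : completeNormedModType R) (y : Y) :
  exists f, dual_ball f /\ f y = `|y|.
Proof.
have [->|y0] := eqVneq y 0.
  exists (fun=> 0); split; last by rewrite normr0.
  by split=> [a x z|x] /=; [rewrite mulr0 addr0|rewrite normr0].
have yinj : injective (fun a : R => a *: y).
  move=> a b /= /eqP; rewrite -subr_eq0 -scalerBl scaler_eq0 (negbTE y0) orbF.
  by rewrite subr_eq0 => /eqP.
pose coef (x : Y) : R := xget 0 [set a | a *: y = x].
have coefE a : coef (a *: y) = a.
  by rewrite /coef; case: xgetP => [b _ /yinj|H]; [|case: (H a)].
have [|||a _ _ [b _ <-] [c _ <-]|x [a _ <-]|g [gL gq gE]] :=
  @hahn_banach R Y (fun x => `|x|) _ _ (range (fun a : R => a *: y))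
    (fun x => coef x * `|y|).
- exact: ler_normD.
- by move=> a x a0; rewrite normrZ ger0_norm.
- split; first by exists 0 => //; rewrite scale0r.
  move=> a _ _ [b _ <-] [c _ <-]; exists (a * b + c) => //.
  by rewrite scalerDl scalerA.
- by rewrite scalerA -scalerDl !coefE; ring.
- by rewrite coefE normrZ ler_wpM2r// ler_norm.
exists g; split.
  by split=> //; apply: linear_le_norm => // x; rewrite normrN.
by rewrite gE; [rewrite -{1}[y]scale1r coefE mul1r|exists 1; rewrite ?scale1r].
Qed.

Lemma evaluation_norm (Y : completeNormedModType R) (y : Y) :
  `|evaluation y| = `|y|.
Proof.
apply/eqP; rewrite eq_le; apply/andP; split.
  by apply: bfun_norm_le => // -[f [fL fy]]; exact: fy.
have [f [fD <-]] := norming_functional y.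
apply: le_trans (ler_norm _) _.
exact: (bfun_le_norm (evaluation y) (exist _ f fD)).
Qed.

(* Each functional [f] of the dual ball of [Y], pulled back to [E] by [T], is
   extended to [X] without increasing its norm; this gives [S : X -> Z] of norm
   at most the Gelfand bound such that [T - S] vanishes on [E]. *)
Lemma absolute_width_le_gelfand (X Y : completeNormedModType R)
    (T : {linear X -> Y}) n :
  (op_absolute_width n T <= gelfand_number n T)%E.
Proof.
apply: le_ereal_inf_tmp => _ [E [Esub Ecl Ecod] <-].
have rn_ub x : E x -> `|x| <= 1 -> (`|T x|%:E <= restricted_norm T E)%E.
  by move=> Ex x1; apply: ereal_sup_ubound; exists x.
(* An infinite bound is trivial, and [0] in [E] excludes the value [-oo]. *)
case rnE : (restricted_norm T E) rn_ub => [c| |] rn_ub; last 2 first.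
- exact: leey.
- by have := rn_ub 0 Esub.1; rewrite normr0 => /(_ ler01).
have c0 : 0 <= c.
  have := rn_ub 0 Esub.1; rewrite normr0 => /(_ ler01).
  by rewrite lee_fin; apply: le_trans.
have TE x : E x -> `|T x| <= c * `|x|.
  move=> Ex; have [->|x0] := eqVneq x 0; first by rewrite linear0 !normr0 mulr0.
  have Ex' : E (`|x|^-1 *: x).
    by have := Esub.2 `|x|^-1 x 0 Ex Esub.1; rewrite addr0.
  have := rn_ub _ Ex'; rewrite linearZ /= !normrZ normfV normr_id.
  rewrite mulVf ?normr_eq0// lee_fin => /(_ (lexx _)).
  by rewrite ler_pdivrMl ?normr_gt0// mulrC.
pose G := {f : Y -> R | dual_ball f}.
have ext (f : G) : exists g : X -> R,
    [/\ forall a x y, g (a *: x + y) = a * g x + g y,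
      forall x, `|g x| <= c * `|x| & forall x, E x -> g x = sval f (T x)].
  case: f => f [fL fy] /=.
  have [x y|a x a0|a x y Ex Ey|x Ex|g [gL gq gE]] :=
      @hahn_banach R X (fun x => c * `|x|) _ _ E (fun x => f (T x)) Esub.
  - by rewrite -mulrDr ler_wpM2l// ler_normD.
  - by rewrite normrZ ger0_norm//; ring.
  - by rewrite linearP fL.
  - by apply: le_trans (TE x Ex); apply: le_trans (fy _); exact: ler_norm.
  exists g; split=> //; apply: (@linear_le_norm X (fun x => c * `|x|)) => // x.
  by rewrite normrN.
have [g gP] := choice ext.
have gb x : (fun f => g f x) \in @bounded_funs R G.
  by apply/asboolP; exists (c * `|x|) => f; have [_ gx _] := gP f; exact: gx.
pose S x : bfun G := BFun (gb x).
have SL a x y : S (a *: x + y) = a *: S x + S y.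
  by apply: bfunP => f; have [gL _ _] := gP f; exact: gL.
have Sc x : `|S x| <= c * `|x|.
  apply: bfun_norm_le => [|f]; first exact: mulr_ge0.
  by have [_ gx _] := gP f; exact: gx.
pose phi x := evaluation (T x) - S x.
have phiL a x y : phi (a *: x + y) = a *: phi x + phi y.
  by rewrite /phi SL (linearP T) evaluation_linear opprD scalerBr addrACA.
have phiE x : E x -> phi x = 0.
  move=> Ex; apply/eqP; rewrite subr_eq0; apply/eqP/bfunP => f.
  by have [_ _ gE] := gP f; rewrite [RHS]gE.
apply: ge_ereal_inf; exists (kolmogorov_width n
    (@evaluation Y @` closure (T @` @closed_unit_ball R X))).
  exists (bfun G : completeNormedModType R), (@evaluation Y).
  by split=> //; exact: evaluation_norm.
apply: ge_ereal_inf; eexists.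
  exists (range phi) => //; split; last exact: dim_le_range phiE Ecod.
  have phi0 : phi 0 = 0 by exact: phiE Esub.1.
  split; first by exists 0.
  by move=> a _ _ [x _ <-] [y _ <-]; exists (a *: x + y).
apply: ge_ereal_sup => _ [_ [y Ky <-] <-].
(* A point [y] of the closure is within [e] of some [T x]. The approximant [phi x] then leaves the
   error [S x + evaluation (y - T x)], of norm at most [c + e]. *)
apply/lee_addgt0Pr => e e0.
have [_ [[x xB <-] yx]] := Ky (ball y e) (nbhsx_ballx y e e0).
apply: ge_ereal_inf; exists (`|evaluation y - phi x|%:E).
  by exists (phi x); [exists x|].
rewrite -EFinD lee_fin.
have -> : evaluation y - phi x = S x + evaluation (y - T x).
  have -> : evaluation (y - T x) = evaluation y - evaluation (T x).
    exact: linearB.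
  by rewrite /phi opprB addrCA.
apply: le_trans (ler_normD _ _) (lerD _ _).
  by apply: le_trans (Sc x) _; rewrite ler_piMr.
by rewrite evaluation_norm; move: yx; rewrite -ball_normE => /ltW.
Qed.

End absolute_le_gelfand.

(** * Averages over random signs and the choice of sign rows *)

Section sign_average.
Context {R : realType}.
Implicit Types (s y x z : nat -> R) (F G : (nat -> R) -> R) (N : nat).

Definition set_coord s N b : nat -> R := fun k => if k == N then b else s k.

(** The expectation over independent fair signs in the coordinates below [N], with all later
    coordinates equal to [1]. *)
Fixpoint sign_avg N F : R :=
  if N is N'.+1 then
    (sign_avg N' (fun s => F (set_coord s N' 1)) +
     sign_avg N' (fun s => F (set_coord s N' (-1)))) / 2
  else F (fun=> 1).

Lemma sign_avg_ext N F G : F =1 G -> sign_avg N F = sign_avg N G.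
Proof. by move=> /funext ->. Qed.

Lemma sign_avg_le N F G : (forall s, F s <= G s) -> sign_avg N F <= sign_avg N G.
Proof.
elim: N F G => [|N IH] F G FG /=; first exact: FG.
by rewrite ler_pM2r// lerD ?IH.
Qed.

Lemma sign_avg_cst N c : sign_avg N (fun=> c) = c.
Proof. by elim: N => //= N ->; field. Qed.

Lemma sign_avgD N F G :
  sign_avg N (fun s => F s + G s) = sign_avg N F + sign_avg N G.
Proof. by elim: N F G => //= N IH F G; rewrite !IH; field. Qed.

Lemma sign_avgZ N c F : sign_avg N (fun s => c * F s) = c * sign_avg N F.
Proof. by elim: N F => //= N IH F; rewrite !IH; field. Qed.

Lemma sign_avg_sum (I : finType) (P : pred I) (F : I -> (nat -> R) -> R) N :
  sign_avg N (fun s => \sum_(i | P i) F i s) = \sum_(i | P i) sign_avg N (F i).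
Proof.
rewrite unlock /=; elim: (index_enum I) => /= [|i r IH].
  exact: sign_avg_cst.
by case: (P i) => //; rewrite sign_avgD IH.
Qed.

Lemma sign_avg_ge N F :
  exists s, (forall k, s k ^+ 2 = 1) /\ F s <= sign_avg N F.
Proof.
elim: N F => [|N IH] F /=.
  by exists (fun=> 1); split=> // k; rewrite expr1n.
have [s1 [s1P Fs1]] := IH (fun s => F (set_coord s N 1)).
have [s2 [s2P Fs2]] := IH (fun s => F (set_coord s N (-1))).
have [h|h] := leP (F (set_coord s1 N 1)) (F (set_coord s2 N (-1))).
- exists (set_coord s1 N 1); split; last by lra.
  by move=> k; rewrite /set_coord; case: eqP => // _; rewrite expr1n.
- exists (set_coord s2 N (-1)); split; last by lra.
  by move=> k; rewrite /set_coord; case: eqP => // _; rewrite sqrrN expr1n.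
Qed.

Definition dotp N s y : R := \sum_(k < N) s k * y k.

Lemma dotp_set_coord N s b y : dotp N.+1 (set_coord s N b) y = dotp N s y + b * y N.
Proof.
rewrite /dotp big_ord_recr /= /set_coord eqxx; congr (_ + _).
by apply: eq_bigr => i _; rewrite ltn_eqF.
Qed.

Lemma dotpp_ge0 N y : 0 <= dotp N y y.
Proof. by apply: sumr_ge0 => i _; rewrite -expr2 sqr_ge0. Qed.

Lemma sign_avg_dotp2 N y : sign_avg N (fun s => dotp N s y ^+ 2) = dotp N y y.
Proof.
elim: N => [|N IH] /=; first by rewrite /dotp !big_ord0 expr0n.
rewrite [RHS]/dotp big_ord_recr /= -/(dotp N y y) -IH.
under sign_avg_ext do rewrite dotp_set_coord.
under [X in (_ + X) / _]sign_avg_ext do rewrite dotp_set_coord.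
rewrite -sign_avgD.
transitivity (sign_avg N (fun s => 2 * (dotp N s y ^+ 2 + y N * y N)) / 2).
  by congr (_ / _); apply: sign_avg_ext => s; ring.
by rewrite sign_avgZ sign_avgD sign_avg_cst; field.
Qed.

(** The odd terms cancel. With [D] the sum of squares so far and [b] the new entry, the induction
    step is [3 D^2 + 6 D b^2 + b^4 <= 3 (D + b^2)^2]. *)
Lemma sign_avg_dotp4 N y :
  sign_avg N (fun s => dotp N s y ^+ 4) <= 3 * dotp N y y ^+ 2.
Proof.
elim: N => [|N IH] /=; first by rewrite /dotp !big_ord0 !expr0n mulr0.
rewrite [in leRHS]/dotp big_ord_recr /= -/(dotp N y y).
under sign_avg_ext do rewrite dotp_set_coord.
under [X in (_ + X) / _]sign_avg_ext do rewrite dotp_set_coord.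
rewrite -sign_avgD.
have -> : sign_avg N (fun s => (dotp N s y + 1 * y N) ^+ 4 +
    (dotp N s y + (- 1) * y N) ^+ 4) = sign_avg N (fun s =>
    2 * (dotp N s y ^+ 4 + (6 * y N ^+ 2) * dotp N s y ^+ 2 + y N ^+ 4)).
  by apply: sign_avg_ext => s; ring.
rewrite sign_avgZ !sign_avgD sign_avg_cst sign_avgZ sign_avg_dotp2.
have : 0 <= y N ^+ 4 by rewrite (exprM _ 2 2) sqr_ge0.
nra.
Qed.

(** Since [expR t >= 1 + t], it suffices that [(1 + t) (1 - t + t^2) = 1 + t^3 >= 1]. *)
Lemma expRN_le (t : R) : 0 <= t -> expR (- t) <= 1 - t + t ^+ 2.
Proof.
move=> t0; have := expR_ge1Dx t; rewrite expRN => h.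
have e0 := expR_gt0 t.
rewrite -[leLHS]mul1r ler_pdivrMr//.
have : 0 <= t ^+ 3 by rewrite exprn_ge0.
have : 0 <= 1 - t + t ^+ 2 by nra.
nra.
Qed.

(* The lower tail of a sum of squares is controlled by its second and fourth
   moments alone; 1 - 1/12 + 3/144 = 1 - 1/16. *)
Lemma sign_avg_exp_dotp N y : dotp N y y != 0 ->
  sign_avg N (fun s => expR (- (dotp N s y ^+ 2 / (12 * dotp N y y)))) <=
  expR (- 16^-1).
Proof.
move=> y0; set D := dotp N y y in y0 *.
have D0 : 0 < D by rewrite lt_def y0 dotpp_ge0.
apply: le_trans (expR_ge1Dx _).
apply: (@le_trans _ _ (sign_avg N (fun s => 1 + ((- (12 * D)^-1) * dotp N s y ^+ 2
   + ((12 * D)^-1 ^+ 2) * dotp N s y ^+ 4)))).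
  apply: sign_avg_le => s; apply: le_trans (expRN_le _) _.
    by rewrite divr_ge0 ?sqr_ge0// mulr_ge0// ltW.
  by rewrite le_eqVlt; apply/orP; left; apply/eqP; ring.
rewrite !sign_avgD !sign_avgZ sign_avg_cst sign_avg_dotp2 -/D.
have h : (12 * D)^-1 ^+ 2 * sign_avg N (fun s => dotp N s y ^+ 4) <=
   (12 * D)^-1 ^+ 2 * (3 * D ^+ 2).
  by rewrite ler_wpM2l ?sqr_ge0// sign_avg_dotp4.
apply: le_trans (lerD (lexx _) (lerD (lexx _) h)) _.
have -> : (12 * D)^-1 ^+ 2 * (3 * D ^+ 2) = 48^-1 by field.
have -> : - (12 * D)^-1 * D = - 12^-1 by field.
lra.
Qed.

(* The rows are chosen one at a time (method of conditional expectations), so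
   that no product probability space is needed. *)
Lemma sign_rows_exp (I : finType) (P : pred I) (y : I -> nat -> R) N n :
  (forall i, P i -> dotp N (y i) (y i) != 0) ->
  exists s : nat -> nat -> R, (forall r k, s r k ^+ 2 = 1) /\
    \sum_(i | P i) expR (- \sum_(r < n)
       dotp N (s r) (y i) ^+ 2 / (12 * dotp N (y i) (y i))) <=
    #|P|%:R * expR (- 16^-1) ^+ n.
Proof.
move=> yN0; elim: n => [|n [s [sP sn]]].
  exists (fun _ _ => 1); split=> [r k|]; first by rewrite expr1n.
  under eq_bigr do rewrite big_ord0 oppr0 expR0.
  by rewrite sumr_const expr0 mulr1.
pose w i := expR (- \sum_(r < n)
  dotp N (s r) (y i) ^+ 2 / (12 * dotp N (y i) (y i))).
(* The new row does no worse than the average of the weighted sum, and averaging multiplies each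
   weight by at most [expR (- 1/16)]. *)
have [t [tP tn]] := sign_avg_ge N (fun t => \sum_(i | P i)
   w i * expR (- (dotp N t (y i) ^+ 2 / (12 * dotp N (y i) (y i))))).
exists (fun r => if r == n then t else s r); split=> [r k|].
  by case: eqP.
apply: (@le_trans _ _ (\sum_(i | P i)
   w i * expR (- (dotp N t (y i) ^+ 2 / (12 * dotp N (y i) (y i)))))).
  apply: ler_sum => i Pi; rewrite big_ord_recr /= eqxx opprD expRD.
  rewrite /w le_eqVlt; apply/orP; left; apply/eqP; congr (expR (- _) * _).
  by apply: eq_bigr => r _; rewrite ltn_eqF.
apply: le_trans tn _; rewrite sign_avg_sum exprSr mulrA.
apply: (@le_trans _ _ (\sum_(i | P i) w i * expR (- 16^-1))).
  apply: ler_sum => i Pi; rewrite sign_avgZ ler_wpM2l ?expR_ge0//.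
  exact/sign_avg_exp_dotp/yN0.
by rewrite -mulr_suml ler_wpM2r ?expR_ge0.
Qed.

(** A union bound: a single [i] violating the inequality would contribute more than [expR (- n/24)]
    to the sum of [sign_rows_exp], whose total is at most [expR (n/48 - n/16)], the same number. *)
Lemma sign_rows_lower (I : finType) (y : I -> nat -> R) N n :
  #|I|%:R <= expR (n%:R / 48) :> R ->
  exists s : nat -> nat -> R, (forall r k, s r k ^+ 2 = 1) /\
    forall i, n%:R / 2 * dotp N (y i) (y i) <= \sum_(r < n) dotp N (s r) (y i) ^+ 2.
Proof.
move=> In; have [s [sP sn]] :=
  @sign_rows_exp I [pred i | dotp N (y i) (y i) != 0] y N n (fun i => id).
exists s; split=> // i; have [->|i0] := eqVneq (dotp N (y i) (y i)) 0.
  by rewrite mulr0 sumr_ge0// => r _; exact: sqr_ge0.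
have D0 : 0 < dotp N (y i) (y i) by rewrite lt_def i0 dotpp_ge0.
rewrite leNgt; apply/negP => lt.
have : expR (- \sum_(r < n) dotp N (s r) (y i) ^+ 2 / (12 * dotp N (y i) (y i)))
    <= expR (- (n%:R / 24)).
  apply: le_trans (_ : expR (n%:R / 48) * expR (- 16^-1) ^+ n <= _); last first.
    rewrite -expRM_natr -expRD ler_expR; lra.
  apply: le_trans (_ : #|I|%:R * expR (- 16^-1) ^+ n <= _); last first.
    by rewrite ler_wpM2r// exprn_ge0 ?expR_ge0.
  apply: le_trans (le_trans sn _); last first.
    by rewrite ler_wpM2r ?exprn_ge0 ?expR_ge0// ler_nat max_card.
  rewrite (bigD1 i)//= lerDl; apply: sumr_ge0 => j _; exact: expR_ge0.
rewrite ler_expR lerN2 -mulr_suml leNgt => /negP; apply.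
rewrite ltr_pdivrMr ?mulr_gt0//; apply: lt_le_trans lt _; lra.
Qed.

End sign_average.

(** * Euclidean norm against l1 norm on the kernel of a sign matrix *)

Section sign_kernel.
Context {R : realType}.
Implicit Types (s y x z : nat -> R) (N : nat).

Definition add_coord z (a : R) i : nat -> R := fun k => z k + a * (k == i)%:R.

(** The possible values of Maurey's random sum; the lists of length [m] number [(2 N)^m]. *)
Definition add_signs N z (t : seq ('I_N * bool)) : nat -> R :=
  foldl (fun z' (e : 'I_N * bool) => add_coord z' ((-1) ^+ e.2) e.1) z t.

Lemma dotpC N s y : dotp N s y = dotp N y s.
Proof. by apply: eq_bigr => i _; rewrite mulrC. Qed.

Lemma dotp_add_coord N s z a (i : 'I_N) :
  dotp N s (add_coord z a i) = dotp N s z + a * s i.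
Proof.
rewrite /dotp /add_coord; under eq_bigr do rewrite mulrDr.
rewrite big_split /=; congr (_ + _).
rewrite (bigD1 i)//= eqxx big1 ?addr0 => [|j ji]; first by rewrite mulr1 mulrC.
by rewrite (_ : (j == i :> nat) = false) ?mulr0//; exact: negbTE.
Qed.

Lemma dotpp_add_coord N z a (i : 'I_N) :
  dotp N (add_coord z a i) (add_coord z a i) =
  dotp N z z + 2 * a * z i + a ^+ 2.
Proof.
rewrite dotp_add_coord dotpC dotp_add_coord /add_coord eqxx mulr1; ring.
Qed.

(* Maurey's empirical method: the left-hand side is the mean of
   [\sum_r <s r, Y> ^+ 2 - c * <Y, Y>] at [Y = z + Y_1 + ... + Y_m] for
   independent [Y_l] equal to [sgr (x i) e_i] with probability [`|x i|]. *)
Lemma maurey_mean N n m c (s : nat -> nat -> R) x z :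
  (forall r k, s r k ^+ 2 = 1) -> \sum_(k < N) `|x k| = 1 ->
  (forall r, (r < n)%N -> dotp N (s r) x = 0) ->
  (forall t : seq ('I_N * bool), size t = m ->
     c * dotp N (add_signs z t) (add_signs z t) <=
     \sum_(r < n) dotp N (s r) (add_signs z t) ^+ 2) ->
  0 <= \sum_(r < n) dotp N (s r) z ^+ 2 - c * dotp N z z
       - 2 * c * m%:R * dotp N z x - c * (m%:R * (m%:R - 1)) * dotp N x x
       + m%:R * (n%:R - c).
Proof.
move=> sP x1 Ax; elim: m z => [|m IH] z H.
  by have /= := H [::] erefl; rewrite !(mulr0, mul0r) subr0 addr0 subr0 subr_ge0.
pose a (i : 'I_N) : R := (-1) ^+ (x i < 0)%R.
have ax (i : 'I_N) : `|x i| * a i = x i.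
  rewrite /a; have [h|h] := ltP (x i) 0; first by rewrite ltr0_norm// expr1; ring.
  by rewrite ger0_norm// expr0 mulr1.
have a2 (i : 'I_N) : a i ^+ 2 = 1 by rewrite /a sqrr_sign.
(* [E i] is the mean over the remaining [m] summands once the first one equals [a i e_i]. Averaging
   with weights [|x i|] gives the mean for [m + 1], the cross terms with the rows vanishing because
   [x] is in their kernel. *)
pose E (i : 'I_N) : R := \sum_(r < n) dotp N (s r) (add_coord z (a i) i) ^+ 2
       - c * dotp N (add_coord z (a i) i) (add_coord z (a i) i)
       - 2 * c * m%:R * dotp N (add_coord z (a i) i) x
       - c * (m%:R * (m%:R - 1)) * dotp N x x + m%:R * (n%:R - c).
have E0 (i : 'I_N) : 0 <= E i.
  by apply: IH => t tm; apply: (H ((i, x i < 0) :: t)); rewrite /= tm.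
have EE (i : 'I_N) : `|x i| * E i = `|x i| *
    (\sum_(r < n) dotp N (s r) z ^+ 2 - c * dotp N z z
     - 2 * c * m%:R * dotp N z x - c * (m%:R * (m%:R - 1)) * dotp N x x
     + m.+1%:R * (n%:R - c))
  + (2 * (\sum_(r < n) dotp N (s r) z * (x i * s r i)) - 2 * c * (z i * x i)
     - 2 * c * m%:R * (x i * x i)).
  have -> : \sum_(r < n) dotp N (s r) z * (x i * s r i) =
      `|x i| * a i * \sum_(r < n) dotp N (s r) z * s r i.
    by rewrite ax mulr_sumr; apply: eq_bigr => r _; ring.
  rewrite /E dotpp_add_coord a2 (dotpC _ (add_coord _ _ _)) dotp_add_coord.
  rewrite (dotpC _ x z).
  have -> : \sum_(r < n) dotp N (s r) (add_coord z (a i) i) ^+ 2 =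
      \sum_(r < n) dotp N (s r) z ^+ 2 +
      (2 * a i * \sum_(r < n) dotp N (s r) z * s r i + n%:R).
    have -> : n%:R = \sum_(r < n) 1 :> R by rewrite sumr_const card_ord.
    rewrite mulr_sumr -!big_split /=.
    apply: eq_bigr => r _; rewrite dotp_add_coord sqrrD exprMn a2 sP; ring.
  have := ax i; move: (`|x i|) => X; move: (a i) (x i) => A xi <-.
  rewrite -(@natr1 _ m); ring.
have : 0 <= \sum_(i < N) `|x i| * E i.
  by apply: sumr_ge0 => i _; rewrite mulr_ge0.
under eq_bigr do rewrite EE.
rewrite big_split /= -mulr_suml x1 mul1r.
rewrite !big_split /= !sumrN -!mulr_sumr exchange_big /=.
have -> : \sum_(r < n) \sum_(i < N) dotp N (s r) z * (x i * s r i) = 0.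
  apply: big1 => r _; rewrite -mulr_sumr -[X in _ * X]/(dotp N x (s r)).
  by rewrite (dotpC _ x) Ax ?mulr0.
rewrite -/(dotp N z x) -/(dotp N x x) -(@natr1 _ m) => h.
by apply: le_trans h _; rewrite le_eqVlt; apply/orP; left; apply/eqP; ring.
Qed.

(** At [z = 0] and [c = n / 2] the mean in [maurey_mean] equals [(m n / 2) (1 - (m - 1) <x, x>)]. *)
Lemma maurey_kernel N n m (s : nat -> nat -> R) x : (0 < n)%N ->
  (forall r k, s r k ^+ 2 = 1) -> \sum_(k < N) `|x k| = 1 ->
  (forall r, (r < n)%N -> dotp N (s r) x = 0) ->
  (forall t : m.-tuple ('I_N * bool),
     n%:R / 2 * dotp N (add_signs (fun=> 0) t) (add_signs (fun=> 0) t) <=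
     \sum_(r < n) dotp N (s r) (add_signs (fun=> 0) t) ^+ 2) ->
  (0 < m)%N -> (m%:R - 1) * dotp N x x <= 1.
Proof.
move=> n0 sP x1 Ax H m0.
have := @maurey_mean N n m (n%:R / 2) s x (fun=> 0) sP x1 Ax.
have d0 y : dotp N y (fun=> 0) = 0 by apply: big1 => i _; rewrite mulr0.
rewrite (dotpC _ (fun=> 0) x) !d0 big1 => [|r _]; last by rewrite d0 expr0n.
move=> h.
have {}h : 0 <= (m%:R * (n%:R / 2)) * (1 - (m%:R - 1) * dotp N x x).
  apply: le_trans (h _) _; first by move=> t tm; have := H (Tuple (introT eqP tm)).
  by rewrite le_eqVlt; apply/orP; left; apply/eqP; field.
by move: h; rewrite pmulr_rge0 ?subr_ge0// mulr_gt0 ?divr_gt0// ltr0n.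
Qed.

Lemma sign_rows_kernel N n : (0 < N)%N -> (0 < n)%N ->
  exists s : nat -> nat -> R, forall x,
    (forall r, (r < n)%N -> dotp N (s r) x = 0) ->
    n%:R * dotp N x x <= 144 * ln (2 * N%:R) * (\sum_(k < N) `|x k|) ^+ 2.
Proof.
move=> N0 n0; set L := ln (2 * N%:R).
have n0R : 0 < n%:R :> R by rewrite ltr0n.
have N1 : 1 <= N%:R :> R by rewrite ler1n.
have L0 : 0 < L by apply: ln_gt0; lra.
(* The largest [m] for which the [(2 N)^m = expR (m L)] sign sums fit the bound [expR (n / 48)] of
   [sign_rows_lower]. *)
pose m := Num.truncn (n%:R / (48 * L)).
have n48 : 0 <= n%:R / (48 * L) by rewrite divr_ge0 ?ltW// mulr_gt0.
have /andP[m1 m2] := truncn_itv n48; rewrite -/m in m1 m2.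
have [|s [sP H]] := @sign_rows_lower R (m.-tuple ('I_N * bool))%type
    (fun t => add_signs (fun=> 0) t) N n.
  rewrite card_tuple card_prod card_ord card_bool natrX natrM mulrC.
  have -> : 2 * N%:R = expR L by rewrite lnK// posrE; lra.
  rewrite -expRM_natr ler_expR.
  move: m1; rewrite ler_pdivlMr ?mulr_gt0// => m1.
  by rewrite ler_pdivlMr//; lra.
exists s => x Ax.
set S := \sum_(k < N) `|x k|.
have S0 : 0 <= S by apply: sumr_ge0.
have xS (k : 'I_N) : `|x k| <= S.
  by rewrite /S (bigD1 k)//= lerDl; apply: sumr_ge0.
have xxS : dotp N x x <= S ^+ 2.
  rewrite expr2 {2}/S mulr_sumr; apply: ler_sum => k _.
  by rewrite -expr2 -real_normK ?num_real// expr2 ler_wpM2r.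
(* For [m <= 1] one has [n < 96 L], and [<x, x> <= S^2] is enough. *)
have [m_le1|m_gt1] := leqP m 1.
  have : n%:R <= 144 * L.
    move: m2; rewrite ltr_pdivrMr ?mulr_gt0//.
    have : m.+1%:R <= 2 :> R by rewrite ler_nat.
    nra.
  have := dotpp_ge0 N x; have := sqr_ge0 S; nra.
have [S00|Sn0] := eqVneq S 0.
  have -> : dotp N x x = 0.
    by apply/eqP; rewrite eq_le dotpp_ge0 andbT (le_trans xxS)// S00 expr0n.
  by rewrite S00 expr0n !mulr0.
have {}S0 : 0 < S by rewrite lt_def Sn0.
have := @maurey_kernel N n m s (fun k => x k / S) n0 sP.
have dS y : dotp N y (fun k => x k / S) = dotp N y x / S.
  by rewrite /dotp mulr_suml; apply: eq_bigr => k _; rewrite mulrA.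
rewrite dS (dotpC _ _ x) dS => /(_ _ _ H (ltnW m_gt1)) h.
have {}h : (m%:R - 1) * dotp N x x <= S ^+ 2.
  have : (m%:R - 1) * (dotp N x x / S / S) <= 1.
    apply: h => [|r rn]; last by rewrite dS Ax// mul0r.
    under eq_bigr do rewrite normrM normfV (gtr0_norm S0).
    by rewrite -mulr_suml divff.
  by rewrite -mulrA -invfM -expr2 mulrA ler_pdivrMr ?exprn_gt0// mul1r.
(* For [m >= 2], [n < 48 L (m + 1)] and [m + 1 <= 3 (m - 1)]; this is the origin of [144]. *)
have : n%:R <= 144 * L * (m%:R - 1).
  move: m2; rewrite ltr_pdivrMr ?mulr_gt0// -(@natr1 _ m).
  have : 2 <= m%:R :> R by rewrite ler_nat.
  nra.
move=> /(ler_wpM2r (dotpp_ge0 N x)) /le_trans; apply.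
rewrite -[leLHS]mulrA; apply: ler_wpM2l h; rewrite mulr_ge0//; exact: ltW.
Qed.

End sign_kernel.

(** * Comparison of lp, l1 and l2 sums *)

Section power_inequalities.
Context {R : realType}.
Implicit Types (x z c : nat -> R).

(** Each term is [c k * c k^(e - 1) <= c k * S^(e - 1)], with [S] the sum. *)
Lemma sum_powR_le c (e : R) N : 1 <= e -> (forall k, 0 <= c k) ->
  \sum_(k < N) c k `^ e <= (\sum_(k < N) c k) `^ e.
Proof.
move=> e1 c0; set S := \sum_(k < N) c k.
have e0 : 0 < e by lra.
have cS (k : 'I_N) : c k <= S by rewrite /S (bigD1 k)//= lerDl sumr_ge0.
have S0 : 0 <= S by rewrite /S sumr_ge0.
rewrite -[leRHS]mulr_powRB1// {1}/S mulr_suml; apply: ler_sum => k _.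
rewrite -mulr_powRB1// ler_wpM2l// ge0_ler_powR ?nnegrE ?subr_ge0//; exact: cS.
Qed.

(** The tangent at [t = 1] of a concave power, obtained from Young's inequality for the product
    [t^a * 1]. *)
Lemma powR_le_affine (t a : R) : 0 <= t -> 0 < a -> a <= 1 -> t `^ a <= 1 - a + a * t.
Proof.
move=> t0 a0; rewrite le_eqVlt => /orP[/eqP ->|a1].
  by rewrite powRr1//; lra.
have := @conjugate_powR R (t `^ a) 1 a^-1 (1 - a)^-1 (powR_ge0 _ _) ler01.
rewrite !invr_gt0 subr_gt0 !invrK => /(_ a0 a1); rewrite addrC subrK => /(_ erefl).
rewrite -powRrM divff ?gt_eqF// powRr1// powR1; lra.
Qed.

Lemma powR_le_id (t p : R) : 0 <= t -> t <= 1 -> 1 <= p -> t `^ p <= t.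
Proof.
move=> t0 t1 p1; rewrite -mulr_powRB1//; last exact: lt_le_trans p1.
rewrite ler_piMr//; apply: le_trans (_ : 1 `^ (p - 1) <= 1); last by rewrite powR1.
by rewrite ge0_ler_powR ?nnegrE ?subr_ge0.
Qed.

(* Interpolation between l1 and l2: the exponents are [p = (2 - p) + 2 (p - 1)]. *)
Lemma sum_powR_interpolation x (p : R) N : 1 < p -> p <= 2 ->
  \sum_(k < N) `|x k| <= 1 ->
  \sum_(k < N) `|x k| `^ p <= (dotp N x x) `^ (p - 1).
Proof.
move=> p1 p2 x1; set b := dotp N x x.
have [b0|bn0] := eqVneq b 0.
  apply: le_trans (powR_ge0 _ _); rewrite big1// => k _.
  have : b <= 0 by rewrite b0.
  rewrite /b /dotp (bigD1 k)//= => h.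
  have : 0 <= \sum_(i < N | i != k) x i * x i.
    by apply: sumr_ge0 => i _; rewrite -expr2 sqr_ge0.
  move=> h'; have : x k = 0 by nra.
  by move=> ->; rewrite normr0 powR0// gt_eqF//; lra.
have b0 : 0 < b by rewrite lt_def bn0 dotpp_ge0.
(* The tangent bound is applied to [|x k| / b]. After summation the bracket is at most
   [(2 - p) + (p - 1) = 1]. *)
have term k : `|x k| `^ p <=
    b `^ (p - 1) * ((2 - p) * `|x k| + (p - 1) * (x k * x k / b)).
  have [->|xk0] := eqVneq (x k) 0.
    by rewrite normr0 powR0 ?gt_eqF ?mulr_ge0 ?powR_ge0//; lra.
  have t0 : 0 < `|x k| by rewrite normr_gt0.
  have -> : `|x k| `^ p = b `^ (p - 1) * (`|x k| * (`|x k| / b) `^ (p - 1)).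
    rewrite mulrCA -powRM ?divr_ge0 ?ltW// (_ : b * (`|x k| / b) = `|x k|).
      rewrite -[X in X * _]powRr1 ?ltW// -powRD ?(gt_eqF t0) ?implybT//.
      congr (_ `^ _); ring.
    by rewrite mulrC divfK.
  apply: ler_wpM2l; first exact: powR_ge0.
  have := @powR_le_affine (`|x k| / b) (p - 1) (divr_ge0 (ltW t0) (ltW b0)).
  rewrite subr_gt0 lerBlDr (_ : 1 + 1 = 2 :> R)// => /(_ p1 p2).
  move=> /(ler_wpM2l (ltW t0)) /le_trans; apply.
  have -> : x k * x k = `|x k| * `|x k|.
    by rewrite -!expr2 real_normK ?num_real.
  by rewrite le_eqVlt; apply/orP; left; apply/eqP; ring.
apply: le_trans (ler_sum _ (fun (k : 'I_N) _ => term k)) _.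
rewrite -mulr_sumr big_split /= -!mulr_sumr -mulr_suml -/b divff// mulr1.
rewrite ler_piMr ?powR_ge0//; nra.
Qed.

Lemma sqr_powR x (p : R) k : 0 < p -> x k * x k = (`|x k| `^ p) `^ (2 / p).
Proof.
move=> p0; rewrite -powRrM mulrCA divff ?gt_eqF// mulr1 powR_mulrn//.
by rewrite real_normK ?num_real.
Qed.

Lemma sum_powR_le_dotp x (p : R) N : 2 <= p ->
  \sum_(k < N) `|x k| `^ p <= (dotp N x x) `^ (p / 2).
Proof.
move=> p2; have p0 : 0 < p by lra.
apply: le_trans (_ : \sum_(k < N) (x k * x k) `^ (p / 2) <= _); last first.
  apply: (@sum_powR_le (fun k => x k * x k)) => [|k]; first lra.
  by rewrite -expr2 sqr_ge0.
apply: ler_sum => k _; rewrite (@sqr_powR _ p)// -[leRHS]powRrM.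
have -> : 2 / p * (p / 2) = 1 by field; rewrite gt_eqF.
by rewrite powRr1 ?powR_ge0.
Qed.

Lemma dotp_le_powR_sum z (p : R) N : 0 < p -> p <= 2 ->
  dotp N z z <= (\sum_(k < N) `|z k| `^ p) `^ (2 / p).
Proof.
move=> p0 p2; have p21 : 1 <= 2 / p by rewrite ler_pdivlMr// mul1r.
have := @sum_powR_le (fun k => `|z k| `^ p) _ N p21 (fun k => powR_ge0 _ _).
by apply: le_trans; apply: ler_sum => k _; rewrite (@sqr_powR _ p).
Qed.

(** Hölder's inequality, proved by using the tangent of [t^(2/p)] at the mean [s] of the numbers
    [|z k|^p]; in the sum the affine parts add up to [N]. *)
Lemma dotp_le_powR_sum_dim z (p : R) N : (0 < N)%N -> 2 < p ->
  dotp N z z <= N%:R `^ (1 - 2 / p) * (\sum_(k < N) `|z k| `^ p) `^ (2 / p).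
Proof.
move=> N0 p2; have p0 : 0 < p by lra.
have N0R : 0 < N%:R :> R by rewrite ltr0n.
set S := \sum_(k < N) `|z k| `^ p.
have S0 : 0 <= S by apply: sumr_ge0 => k _; exact: powR_ge0.
have [S00|Sn0] := eqVneq S 0.
  have -> : dotp N z z = 0.
    apply: big1 => k _; have := S00; rewrite /S => /eqP.
    rewrite psumr_eq0 => [|i _]; last exact: powR_ge0.
    move=> /allP /(_ k (mem_index_enum _)) /eqP h.
    by rewrite (@sqr_powR _ p)// h powR0// gt_eqF// divr_gt0.
  by rewrite mulr_ge0 ?powR_ge0.
have {}S0 : 0 < S by rewrite lt_def Sn0.
set s := S / N%:R; have s0 : 0 < s by rewrite divr_gt0.
have a1 : 2 / p <= 1 by rewrite ler_pdivrMr// mul1r ltW.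
have a0 : 0 < 2 / p by rewrite divr_gt0.
have term k : z k * z k <= s `^ (2 / p) * (1 - 2 / p + 2 / p * (`|z k| `^ p / s)).
  rewrite (@sqr_powR _ p)//.
  have -> : `|z k| `^ p = s * (`|z k| `^ p / s) by rewrite mulrC divfK ?gt_eqF.
  have t0 : 0 <= `|z k| `^ p / s by rewrite divr_ge0 ?powR_ge0 ?ltW.
  rewrite powRM ?(ltW s0)// ler_wpM2l ?powR_ge0//.
  by rewrite [s * _]mulrC mulfK ?gt_eqF//; exact: powR_le_affine.
apply: le_trans (ler_sum _ (fun (k : 'I_N) _ => term k)) _.
rewrite -mulr_sumr big_split /= -mulr_sumr -mulr_suml -/S sumr_const card_ord.
have -> : S / s = N%:R by rewrite /s; field; rewrite !gt_eqF.
rewrite -[(1 - 2 / p) *+ N]mulr_natr -mulrDl subrK mul1r /s powRM ?invr_ge0 ?(ltW S0)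
  ?(ltW N0R)//.
rewrite powRB ?(gt_eqF N0R) ?implybT// powRr1 ?(ltW N0R)// -(powR_inv1 (ltW N0R)).
rewrite -powRrM mulN1r powRN.
by rewrite le_eqVlt; apply/orP; left; apply/eqP; ring.
Qed.

End power_inequalities.

(** * Norms in lp through partial sums *)

Section ell_sums.
Context {R : realType}.

Lemma nneseries_le_bound (u : nat -> R) (C : R) : (forall k, 0 <= u k) ->
  (forall N, \sum_(k < N) u k <= C) -> (\sum_(k <oo) (u k)%:E <= C%:E)%E.
Proof.
move=> u0 uC; apply: lime_le.
  by apply: is_cvg_nneseries => k _ _; rewrite lee_fin.
by apply: nearW => N; rewrite sumEFin lee_fin big_mkord.
Qed.

Lemma ell_norm_le (p : R) (p1 : 1 <= p) (x : ell p1) C : 0 <= C ->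
  (forall N, \sum_(k < N) `|x k| `^ p <= C `^ p) -> `|x| <= C.
Proof.
move=> C0 H; have p0 : 0 < p by exact: (lt_le_trans ltr01 p1).
have : (\sum_(k <oo) (`|x k| `^ p)%:E <= (C `^ p)%:E)%E.
  by apply: nneseries_le_bound => // k; exact: powR_ge0.
rewrite -normr_ellE lee_fin => h; rewrite leNgt; apply/negP => xC.
move: h; rewrite leNgt => /negP; apply.
by apply: gt0_ltr_powR; rewrite ?nnegrE.
Qed.

Lemma ell1_sum_le (x : ell (lexx (1 : R))) N : \sum_(k < N) `|x k| <= `|x|.
Proof.
have := ell_sum_le x N; rewrite powRr1; last exact: ell_norm_ge0.
by under eq_bigr do rewrite powRr1 ?normr_ge0//.
Qed.

Lemma ell1_coord_le (x : ell (lexx (1 : R))) k : `|x k| <= `|x|.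
Proof. exact: ell_coord_le. Qed.

End ell_sums.

(** * Diagonal operators from l1 to lp *)

Section diagonal_operator.
Context {R : realType} (p : R) (p1 : 1 <= p) (d : nat -> R).
Hypothesis d1 : forall k, `|d k| <= 1.

Lemma diag_sum_le (x : ell (lexx (1 : R))) N :
  \sum_(k < N) `|d k * x k| `^ p <= `|x| `^ p.
Proof.
have p0 : 0 < p by exact: (lt_le_trans ltr01 p1).
apply: le_trans (_ : (\sum_(k < N) `|x k|) `^ p <= _); last first.
  apply: ge0_ler_powR; rewrite ?nnegrE ?sumr_ge0 ?(ltW p0)//.
  exact: ell1_sum_le.
apply: le_trans (_ : \sum_(k < N) `|x k| `^ p <= _); last first.
  exact: (@sum_powR_le _ (fun k => `|x k|)).
apply: ler_sum => k _; apply: ge0_ler_powR; rewrite ?nnegrE ?(ltW p0)//.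
by rewrite normrM ler_piMl.
Qed.

Lemma diag_summable (x : ell (lexx (1 : R))) :
  (\sum_(k <oo) (`|d k * x k| `^ p)%:E < +oo)%E.
Proof.
apply: le_lt_trans (ltry (`|x| `^ p)).
by apply: nneseries_le_bound; [move=> k; exact: powR_ge0|exact: diag_sum_le].
Qed.

Definition diag_fun (x : ell (lexx (1 : R))) : ell p1 := ell_of p1 (diag_summable x).

Lemma diag_fun_linear : linear diag_fun.
Proof.
move=> a x y; apply: ellP => k.
change (d k * (a * x k + y k) = a * (d k * x k) + d k * y k); ring.
Qed.

HB.instance Definition _ := GRing.isLinear.Build R (ell (lexx (1 : R))) (ell p1) _
  diag_fun diag_fun_linear.

Definition diag_op : {linear ell (lexx (1 : R)) -> ell p1} := diag_fun.

Lemma diag_op_norm x : `|diag_op x| <= `|x|.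
Proof. by apply: ell_norm_le => // N; exact: diag_sum_le. Qed.

Lemma diag_op_bounded : bounded_operator diag_op.
Proof. by exists 1 => x; rewrite mul1r diag_op_norm. Qed.

End diagonal_operator.

(** * Upper bound for the Gelfand numbers *)

Section gelfand_bound.
Context {R : realType}.

Definition decay (alpha : R) (k : nat) : R := k.+1%:R `^ (- alpha).

Lemma decay_le1 alpha k : 0 <= alpha -> `|decay alpha k| <= 1.
Proof.
move=> a0; rewrite ger0_norm ?powR_ge0// /decay -[leRHS](powRr0 k.+1%:R).
by rewrite ler_powR ?ler1n// oppr_le0.
Qed.

Lemma dotpDr N s (a : R) x y :
  dotp N s (fun k => a * x k + y k) = a * dotp N s x + dotp N s y.
Proof.
rewrite /dotp mulr_sumr -big_split /=; apply: eq_bigr => k _; ring.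
Qed.

Lemma closed_kernel (X : completeNormedModType R) n (phi : 'I_n -> X -> R)
    (K : 'I_n -> R) :
  (forall r a x y, phi r (a *: x + y) = a * phi r x + phi r y) ->
  (forall r x, `|phi r x| <= K r * `|x|) ->
  closed [set x | forall r, phi r x = 0].
Proof.
move=> L phiK x xcl r; apply/eqP; rewrite -normr_le0; apply/ler_addgt0Pr => e e0.
rewrite add0r.
have K1 : 0 < `|K r| + 1 by rewrite ltr_wpDl.
have d0 : 0 < e / (`|K r| + 1) by rewrite divr_gt0.
have [y [yE /=]] := xcl (ball x (e / (`|K r| + 1))) (nbhsx_ballx _ _ d0).
rewrite -ball_normE /= => xy.
have -> : phi r x = phi r (x - y).
  by rewrite addrC -scaleN1r L yE mulr0 add0r.
apply: le_trans (phiK _ _) _.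
apply: le_trans (_ : (`|K r| + 1) * `|x - y| <= _).
  by rewrite ler_wpM2r// (le_trans (ler_norm _))// lerDl.
by rewrite mulrC -ler_pdivlMr// ltW.
Qed.

Lemma ln_le_sub1 (t : R) : 0 < t -> ln t <= t - 1.
Proof. by move=> t0; have := expR_ge1Dx (ln t); rewrite lnK ?posrE//; lra. Qed.

(** Both cases of the theorem are covered by the rate [r]. The last hypothesis is
    [|x|_p <= |x|_2^(2 r)] on the l1 ball, which turns a bound of order [L / n] on [|x|_2^2] into
    one of order [(L / n)^r] on [|x|_p]. *)
Lemma gelfand_diag_le (p alpha r : R) (p1 : 1 <= p)
    (d1 : forall k, `|decay alpha k| <= 1) :
  0 < alpha -> 0 < r -> r <= 1 ->
  (forall N (x : nat -> R), \sum_(k < N) `|x k| <= 1 ->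
     \sum_(k < N) `|x k| `^ p <= (dotp N x x) `^ (r * p)) ->
  exists2 beta, 0 < beta & forall n, (0 < n)%N ->
    (gelfand_number n (diag_op p1 d1) <=
      (beta * (1 + ln n%:R) * n%:R `^ (- r))%:E)%E.
Proof.
move=> a0 r0 r1 Hp.
have p0 : 0 < p by exact: (lt_le_trans ltr01 p1).
pose B := 144 * (2 + r / alpha).
have B0 : 0 < B by rewrite mulr_gt0// addr_gt0// divr_gt0.
(* In [beta^p] the coordinates below [M] account for [B^(r p)] and the tail for [1]. *)
pose beta := (B `^ (r * p) + 1) `^ p^-1.
have b0 : 0 < B `^ (r * p) + 1 by rewrite ltr_wpDl ?powR_ge0.
exists beta => [|n n0]; first exact: powR_gt0.
have n0R : 0 < n%:R :> R by rewrite ltr0n.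
have n1R : 1 <= n%:R :> R by rewrite ler1n.
set L := 1 + ln n%:R.
have L1 : 1 <= L by rewrite lerDl ln_ge0.
have L0 : 0 < L by apply: lt_le_trans L1.
(* Chosen so that [M0^(- alpha) = n^(- r)]: beyond [M] the diagonal entries alone give the required
   rate. *)
pose M0 := n%:R `^ (r / alpha) : R.
pose M := (Num.truncn M0).+1.
have M01 : 1 <= M0 by rewrite -(powRr0 n%:R) ler_powR// divr_ge0 ?ltW.
have /andP[M1 M2] := truncn_itv (powR_ge0 n%:R (r / alpha)).
have MM0 : M%:R <= 2 * M0.
  by rewrite /M -natr1; move: M1; rewrite -/M0 => M1; lra.
have lnM : ln (2 * M%:R) <= (2 + r / alpha) * L.
  apply: le_trans (_ : ln (4 * M0) <= _).
    rewrite ler_ln ?posrE ?mulr_gt0 ?powR_gt0 ?ltr0n//; lra.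
  rewrite lnM ?posrE ?powR_gt0// ln_powR.
  have -> : 4 = 2 * 2 :> R by ring.
  rewrite lnM ?posrE//.
  have := @ln_le_sub1 2 (ltr0Sn _ 1); have := ln_ge0 n1R.
  have : 0 <= r / alpha by rewrite divr_ge0 ?ltW.
  rewrite /L; nra.
have [s sP] := @sign_rows_kernel R M n (ltn0Sn _) n0.
pose phi (i : 'I_n) (x : ell (lexx (1 : R))) := dotp M (s i) x.
have phiL i a x y : phi i (a *: x + y) = a * phi i x + phi i y.
  by rewrite /phi -dotpDr.
have phiK i x : `|phi i x| <= (\sum_(k < M) `|s i k|) * `|x|.
  rewrite /phi /dotp mulr_suml (le_trans (ler_norm_sum _ _ _))//.
  by apply: ler_sum => k _; rewrite normrM ler_wpM2l// ell1_coord_le.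
pose E := [set x | forall i, phi i x = 0].
apply: ge_ereal_inf; exists (restricted_norm (diag_op p1 d1) E).
  exists E => //; split; [|exact: closed_kernel phiL phiK|exact: codim_le_functionals].
  split=> [i|a x y /= xE yE i]; last by rewrite phiL xE yE mulr0 addr0.
  by apply: big1 => k _; rewrite mulr0.
apply: ge_ereal_sup => _ [x [xE x1] <-]; rewrite lee_fin.
have {}x1 : `|x| <= 1 by [].
have C0 : 0 <= beta * L * n%:R `^ (- r) by rewrite !mulr_ge0 ?powR_ge0// ltW.
have xN1 N : \sum_(k < N) `|x k| <= 1 by exact: le_trans (ell1_sum_le x N) x1.
have dotx : dotp M x x <= B * L / n%:R.
  rewrite ler_pdivlMr// mulrC.
  apply: le_trans (sP x _) _ => [i ilt|]; first exact: (xE (Ordinal ilt)).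
  apply: le_trans (_ : 144 * ln (2 * M%:R) <= _).
    rewrite ler_piMr//; last by rewrite expr_le1// sumr_ge0.
    rewrite mulr_ge0// ln_ge0//.
    have : 1 <= M%:R :> R by rewrite ler1n.
    lra.
  by rewrite /B -mulrA ler_wpM2l.
clearbody B.
have tail k : (M <= k)%N -> `|decay alpha k * x k| `^ p <= n%:R `^ (- (r * p)) * `|x k|.
  move=> Mk; rewrite normrM powRM// ler_pM ?powR_ge0//; last first.
    by apply: powR_le_id => //; exact: le_trans (ell1_coord_le x k) x1.
  rewrite ger0_norm ?powR_ge0// /decay -powRrM.
  have -> : n%:R `^ (- (r * p)) = M0 `^ (- alpha * p).
    by rewrite /M0 -powRrM; congr (_ `^ _); field; rewrite gt_eqF.
  rewrite mulNr !powRN lef_pV2 ?posrE ?powR_gt0 ?(lt_le_trans ltr01 M01)//.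
  rewrite ge0_ler_powR ?nnegrE ?powR_ge0//; first by rewrite mulr_ge0 ?ltW.
  apply: le_trans (ltW M2) _; rewrite ler_nat; exact: leq_trans Mk _.
apply: ell_norm_le => // N.
(* The partial sum is lengthened so that it can be split at [M] whatever [N] is. *)
apply: le_trans (_ : \sum_(k < M + N) `|decay alpha k * x k| `^ p <= _).
  rewrite addnC big_split_ord /= lerDl; apply: sumr_ge0 => k _; exact: powR_ge0.
rewrite big_split_ord /=.
apply: le_trans (_ : (B * L / n%:R) `^ (r * p) + n%:R `^ (- (r * p)) <= _).
  apply: lerD.
    apply: le_trans (_ : \sum_(k < M) `|x k| `^ p <= _).
      apply: ler_sum => k _; apply: ge0_ler_powR; rewrite ?nnegrE ?(ltW p0)//.
      by rewrite normrM ler_piMl.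
    apply: le_trans (Hp _ _ (xN1 _)) _.
    have rp0 : 0 <= r * p by rewrite mulr_ge0// ltW.
    by apply: ge0_ler_powR; rewrite ?nnegrE ?dotpp_ge0// (le_trans _ dotx)// dotpp_ge0.
  apply: le_trans (_ : \sum_(k < N) n%:R `^ (- (r * p)) * `|x (M + k)%N| <= _).
    by apply: ler_sum => k _; apply: tail; exact: leq_addr.
  rewrite -mulr_sumr ler_piMr ?powR_ge0//.
  apply: le_trans (xN1 (M + N)%N); rewrite big_split_ord /= lerDr; exact: sumr_ge0.
have -> : (beta * L * n%:R `^ (- r)) `^ p =
    (B `^ (r * p) + 1) * L `^ p * n%:R `^ (- (r * p)).
  rewrite !powRM ?mulr_ge0 ?powR_ge0 ?(ltW L0)// /beta -!powRrM.
  by rewrite mulVf ?gt_eqF// powRr1 ?(ltW b0)// mulNr.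
have -> : (B * L / n%:R) `^ (r * p) = B `^ (r * p) * L `^ (r * p) * n%:R `^ (- (r * p)).
  rewrite !powRM ?mulr_ge0 ?invr_ge0 ?ltW//; congr (_ * _).
  by rewrite -(powR_inv1 (ltW n0R)) -powRrM mulN1r.
rewrite -[X in _ + X]mul1r -mulrDl ler_wpM2r ?powR_ge0// mulrDl mul1r lerD//.
  by rewrite ler_wpM2l ?powR_ge0// ler_powR// ler_piMl// ltW.
by rewrite -(powRr0 L) ler_powR// ltW.
Qed.

End gelfand_bound.

(** * Lower bound for the Kolmogorov widths *)

Section kolmogorov_bound.
Context {R : realType}.
Implicit Types (z : nat -> R) (w : nat -> nat -> R).

Lemma dotpDl N (a : R) x y s :
  dotp N (fun k => a * x k + y k) s = a * dotp N x s + dotp N y s.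
Proof. by rewrite dotpC dotpDr !(dotpC _ s). Qed.

Lemma dotpZl N (a : R) x s : dotp N (fun k => a * x k) s = a * dotp N x s.
Proof. by rewrite /dotp mulr_sumr; apply: eq_bigr => k _; rewrite mulrA. Qed.

(** Orthogonality to [K] vectors is a homogeneous system with a nonzero solution supported on the
    first [K + 1] coordinates; it is then normalised. *)
Lemma orthogonal_unit_vector N (cs : seq (nat -> R)) : (size cs < N)%N ->
  exists w : nat -> R, dotp N w w = 1 /\ forall c, c \in cs -> dotp N w c = 0.
Proof.
move=> csN; set K := size cs in csN.
have [a [aP [i0 ai0]]] :=
  @underdetermined_system R K (fun i j => nth (fun=> 0) cs j i).
pose v (k : nat) : R := if insub k is Some i then a i else 0.
have vE (i : 'I_K.+1) : v i = a i by rewrite /v valK.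
have dv c : dotp N v c = \sum_(i < K.+1) a i * c i.
  transitivity (\sum_(i < K.+1) v i * c i); last first.
    by apply: eq_bigr => i _; rewrite vE.
  rewrite /dotp (big_ord_widen N (fun k => v k * c k) csN) [RHS]big_mkcond.
  by apply: eq_bigr => k _; case: ifPn => // kK; rewrite /v insubN// mul0r.
have vv : 0 < dotp N v v.
  rewrite dv (bigD1 i0)//= vE ltr_wpDr//.
    by apply: sumr_ge0 => i _; rewrite vE -expr2 sqr_ge0.
  by rewrite -expr2 exprn_even_gt0.
pose t := (Num.sqrt (dotp N v v))^-1.
exists (fun k => t * v k); split.
  rewrite dotpZl dotpC dotpZl mulrA -expr2 exprVn sqr_sqrtr ?(ltW vv)//.
  by rewrite mulVf ?gt_eqF.
move=> c cs_c; rewrite dotpZl dv.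
have -> : \sum_(i < K.+1) a i * c i = 0.
  have ic : (index c cs < K)%N by rewrite index_mem.
  rewrite -[RHS](aP (Ordinal ic)).
  by apply: eq_bigr => i _; rewrite /= nth_index.
by rewrite mulr0.
Qed.

Lemma orthonormal_complement N (bs : seq (nat -> R)) k : (size bs + k <= N)%N ->
  exists w, (forall i b, (i < k)%N -> b \in bs -> dotp N (w i) b = 0) /\
    forall i j, (i < k)%N -> (j < k)%N -> dotp N (w i) (w j) = (i == j)%:R.
Proof.
elim: k => [|k IH] bN; first by exists (fun _ _ => 0).
have [w [wb ww]] : exists w, (forall i b, (i < k)%N -> b \in bs -> dotp N (w i) b = 0)
    /\ forall i j, (i < k)%N -> (j < k)%N -> dotp N (w i) (w j) = (i == j)%:R.
  by apply: IH; apply: leq_trans bN; rewrite addnS.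
have [|v [v1 vP]] := @orthogonal_unit_vector N (bs ++ [seq w i | i <- iota 0 k]).
  by rewrite size_cat size_map size_iota -addnS.
have vw i : (i < k)%N -> dotp N v (w i) = 0.
  by move=> ik; apply: vP; rewrite mem_cat map_f ?orbT// mem_iota.
exists (fun i => if i == k then v else w i); split=> [i b|i j]; rewrite !ltnS.
  case: eqP => [_ _ bb|/eqP ik ik']; first by apply: vP; rewrite mem_cat bb.
  by apply: wb; rewrite ltn_neqAle ik.
have [->|ik] := eqVneq i k; have [->|jk] := eqVneq j k => ik' jk'.
- by rewrite v1 ?eqxx.
- by rewrite vw ?ltn_neqAle ?jk ?jk'.
- by rewrite dotpC vw ?(negbTE ik) ?ltn_neqAle ?ik ?ik'.
- by apply: ww; rewrite ltn_neqAle ?ik ?jk.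
Qed.

(** Projections are removed one at a time; the squared norm of the residual [y] is the difference of
    the two sides, hence nonnegative. *)
Lemma bessel N w k z :
  (forall i j, (i < k)%N -> (j < k)%N -> dotp N (w i) (w j) = (i == j)%:R) ->
  \sum_(j < k) dotp N (w j) z ^+ 2 <= dotp N z z.
Proof.
move=> ww; suff : forall m, (m <= k)%N -> exists y, [/\
    dotp N y y = dotp N z z - \sum_(j < m) dotp N (w j) z ^+ 2 &
    forall j, (m <= j)%N -> (j < k)%N -> dotp N (w j) y = dotp N (w j) z].
  by move=> /(_ k (leqnn k)) [y [yy _]]; rewrite -subr_ge0 -yy dotpp_ge0.
elim=> [|m IH] mk; first by exists z; split=> //; rewrite big_ord0 subr0.
have [y [yy yw]] := IH (ltnW mk).
have wy := yw m (leqnn m) mk.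
exists (fun l => - dotp N (w m) z * w m l + y l); split.
  have wm : dotp N (w m) (w m) = 1 by rewrite ww ?eqxx.
  rewrite dotpDl !dotpDr big_ord_recr /= yy (dotpC _ y (w m)) wy wm; ring.
move=> j mj jk; rewrite dotpDr ww// (gtn_eqF mj) yw//; last exact: ltnW.
by rewrite mulr0 add0r.
Qed.

Lemma indicator_sum_le (p : R) i N : 0 < p ->
  \sum_(k < N) `|(k == i :> nat)%:R : R| `^ p <= 1.
Proof.
move=> p0; have [iN|Ni] := ltnP i N; last first.
  rewrite big1// => k _; rewrite (ltn_eqF (leq_trans (ltn_ord k) Ni)).
  by rewrite normr0 powR0// gt_eqF.
rewrite (bigD1 (Ordinal iN))//= eqxx normr1 powR1 big1 ?addr0// => k /negbTE ki.
have -> : (k == i :> nat) = false by exact: ki.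
by rewrite normr0 powR0// gt_eqF.
Qed.

Lemma indicator_summable (p : R) i : 0 < p ->
  (\sum_(k <oo) (`|(k == i)%:R : R| `^ p)%:E < +oo)%E.
Proof.
move=> p0; apply: le_lt_trans (ltry 1); apply: nneseries_le_bound => [k|N].
  exact: powR_ge0.
exact: indicator_sum_le.
Qed.

Definition basis_vector i : ell (lexx (1 : R)) :=
  ell_of (lexx 1) (@indicator_summable 1 i ltr01).

Lemma basis_vector_norm i : `|basis_vector i| <= 1.
Proof. by apply: ell_norm_le => // N; rewrite powR1; exact: indicator_sum_le. Qed.

(** The exponent [h] measures the loss [|z|_2 <= N^h |z|_p] in dimension [N]. If all images of basis
    vectors were within [delta] of [V], the total squared Euclidean length of the first [2 n]
    residuals would be both too large and too small. *)
Lemma kolmogorov_diag_ge (p alpha h : R) (p1 : 1 <= p)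
    (d1 : forall k, `|decay alpha k| <= 1) : 0 < alpha ->
  (forall N z, (0 < N)%N -> dotp N z z <=
     N%:R `^ (2 * h) * (\sum_(k < N) `|z k| `^ p) `^ (2 / p)) ->
  exists2 gamma, 0 < gamma & forall n, (0 < n)%N ->
    ((gamma * n%:R `^ (- h - alpha))%:E <= op_kolmogorov_width n (diag_op p1 d1))%E.
Proof.
move=> a0 Hp; have p0 : 0 < p by exact: (lt_le_trans ltr01 p1).
(* The power of [2] converts [n] into [N = 2 n], and the factor [1/2] makes the upper estimate
   [N * N^(2 h) * delta^2] equal to half of the lower one, [n * N^(- 2 alpha)]. *)
exists (2^-1 * 2 `^ (- h - alpha)) => [|n n0]; first by rewrite mulr_gt0 ?powR_gt0.
pose N := (n + n)%N.
have N0 : (0 < N)%N by rewrite addn_gt0 n0.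
have N0R : 0 < N%:R :> R by rewrite ltr0n.
have NE : N%:R = 2 * n%:R :> R by rewrite natrD; ring.
set delta := _ * _ `^ _.
have deltaE : delta = 2^-1 * N%:R `^ (- h - alpha).
  by rewrite NE powRM// mulrA.
have delta0 : 0 < delta by rewrite deltaE mulr_gt0 ?powR_gt0.
rewrite leNgt; apply/negP => /ereal_inf_lt [_ [V [Vsub [m mn [b [bV _]]]] <-] lt].
have ex i : exists v, V v /\ `|diag_op p1 d1 (basis_vector i) - v| < delta.
  have : (ereal_inf [set `|diag_op p1 d1 (basis_vector i) - z|%:E | z in V] < delta%:E)%E.
    apply: le_lt_trans lt; apply: ereal_sup_ubound.
    exists (diag_op p1 d1 (basis_vector i)) => //; apply: subset_closure.
    by exists (basis_vector i) => //; exact: basis_vector_norm.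
  by move=> /ereal_inf_lt [_ [v Vv <-]]; rewrite lte_fin => lt'; exists v.
have [v vP] := choice ex.
pose bs := [seq (b i : nat -> R) | i <- enum 'I_m].
have [|w [wb ww]] := @orthonormal_complement N bs n.
  by rewrite size_map size_enum_ord leq_add2r.
have wV j y : (j < n)%N -> V y -> dotp N (w j) y = 0.
  move=> jn; rewrite -bV => -[a _ <-]; rewrite /lincomb.
  elim/big_ind : _ => [|x1 x2 h1 h2|i _].
  - by apply: big1 => k _; rewrite mulr0.
  - transitivity (dotp N (w j) (fun k => 1 * x1 k + x2 k)).
      by apply: eq_bigr => k _; rewrite mul1r.
    by rewrite dotpDr h1 h2 mulr0 addr0.
  - transitivity (dotp N (fun k => a i * b i k) (w j)); first exact: dotpC.
    rewrite dotpZl dotpC wb ?mulr0//; apply: map_f; rewrite mem_enum//.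
pose z i : nat -> R := diag_op p1 d1 (basis_vector i) - v i.
have wz j (i : 'I_N) : (j < n)%N -> dotp N (w j) (z i) = decay alpha i * w j i.
  move=> jn.
  transitivity (dotp N (w j)
    (add_coord (fun k => (-1) * v i k) (decay alpha i) i)).
    apply: eq_bigr => k _; congr (_ * _).
    rewrite /add_coord mulN1r addrC /z.
    change (decay alpha k * (k == i :> nat)%:R - v i k =
      decay alpha i * (k == i :> nat)%:R - v i k).
    by case: (eqVneq (k : nat) i) => [->|]; rewrite ?mulr0.
  rewrite dotp_add_coord dotpC dotpZl dotpC wV ?mulr0 ?add0r//.
  by have [] := vP i.
(* By Bessel, after exchanging the sums, each unit vector [w j] contributes at least the square of
   the smallest diagonal entry, [N^(- 2 alpha)]. *)
have lower : n%:R * N%:R `^ (- (2 * alpha)) <= \sum_(i < N) dotp N (z i) (z i).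
  apply: le_trans (_ : \sum_(i < N) \sum_(j < n) dotp N (w j) (z i) ^+ 2 <= _);
    last by apply: ler_sum => i _; exact: bessel.
  rewrite exchange_big /= -{1}[n]card_ord mulr_natl -sumr_const.
  apply: ler_sum => j _.
  apply: le_trans (_ : \sum_(i < N) N%:R `^ (- (2 * alpha)) * (w j i * w j i) <= _).
    rewrite -mulr_sumr -[X in _ <= _ * X]/(dotp N (w j) (w j)) ww// eqxx mulr1//.
  apply: ler_sum => i _; rewrite wz// exprMn -!expr2 ler_wpM2r ?sqr_ge0//.
  rewrite -powR_mulrn ?powR_ge0// /decay -powRrM mulNr !powRN (mulrC alpha).
  rewrite lef_pV2 ?posrE ?powR_gt0//.
  have a20 : 0 <= 2 * alpha by rewrite mulr_ge0// ltW.
  by rewrite ge0_ler_powR ?nnegrE// ler_nat.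
have upper (i : 'I_N) : dotp N (z i) (z i) <= N%:R `^ (2 * h) * delta ^+ 2.
  apply: le_trans (Hp N (z i) N0) _; rewrite ler_wpM2l ?powR_ge0//.
  apply: le_trans (_ : (delta `^ p) `^ (2 / p) <= _); last first.
    by rewrite -powRrM mulrCA divff ?gt_eqF// mulr1 powR_mulrn ?(ltW delta0).
  have vlt : `|diag_op p1 d1 (basis_vector i) - v i| < delta by have [] := vP i.
  have p20 : 0 <= 2 / p by rewrite divr_ge0 ?ltW.
  apply: ge0_ler_powR; rewrite ?nnegrE ?powR_ge0 ?sumr_ge0//.
  apply: le_trans (ell_sum_le (diag_op p1 d1 (basis_vector i) - v i) N) _.
  apply: ge0_ler_powR; rewrite ?nnegrE ?(ltW p0) ?(ltW delta0) ?(ltW vlt)//.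
  exact: ell_norm_ge0.
have := le_trans lower (ler_sum _ (fun i _ => upper i)).
rewrite sumr_const card_ord -[leRHS]mulr_natl deltaE exprMn.
rewrite -(powR_mulrn 2 (powR_ge0 _ _)) -powRrM.
have -> : N%:R `^ ((- h - alpha) * 2) =
    N%:R `^ (- (2 * h)) * N%:R `^ (- (2 * alpha)).
  by rewrite -powRD ?(gt_eqF N0R) ?implybT//; congr (_ `^ _); ring.
rewrite (powRN _ (2 * h)) NE.
have : 0 < N%:R `^ (2 * h) by rewrite powR_gt0.
have : 0 < N%:R `^ (- (2 * alpha)) by rewrite powR_gt0.
rewrite -NE; move: (N%:R `^ (2 * h)) (N%:R `^ (- (2 * alpha))) => A C C0 A0.
have n0R : 0 < n%:R :> R by rewrite ltr0n.
rewrite NE (_ : 2 * n%:R * (A * (2^-1 ^+ 2 * (A^-1 * C))) = n%:R * C / 2).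
  have : 0 < n%:R * C by rewrite mulr_gt0.
  lra.
by field; rewrite gt_eqF.
Qed.

End kolmogorov_bound.

Theorem proposition6p3 (R : realType) :
  (forall (p q alpha : R) (p_gt1 : 1 < p),
     p <= 2 -> p^-1 + q^-1 = 1 -> 0 < alpha -> alpha < q^-1 ->
     exists beta gamma : R, [/\ 0 < beta, 0 < gamma &
       exists u : {linear ell (lexx (1 : R)) -> ell (ltW p_gt1)},
         bounded_operator u /\
         forall n : nat, (0 < n)%N ->
           [/\ (op_absolute_width n u <= gelfand_number n u)%E,
               (gelfand_number n u <=
                  (beta * (1 + ln n%:R) * n%:R `^ (- q^-1))%:E)%E &
               ((gamma * n%:R `^ (- alpha))%:E <= op_kolmogorov_width n u)%E]])
  /\
  (forall (p alpha : R) (p_gt2 : 2 < p),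
     0 < alpha -> alpha < p^-1 ->
     exists beta gamma : R, [/\ 0 < beta, 0 < gamma &
       exists u : {linear ell (lexx (1 : R)) -> ell (gt2_ge1 p_gt2)},
         bounded_operator u /\
         forall n : nat, (0 < n)%N ->
           [/\ (op_absolute_width n u <= gelfand_number n u)%E,
               (gelfand_number n u <=
                  (beta * (1 + ln n%:R) * n%:R `^ (- 2^-1))%:E)%E &
               ((gamma * n%:R `^ (p^-1 - 2^-1 - alpha))%:E <=
                  op_kolmogorov_width n u)%E]]).
Proof.
split=> [p q alpha p_gt1 p2 pq a0 aq|p alpha p_gt2 a0 ap].
  have d1 k : `|decay alpha k| <= 1 by exact: decay_le1 (ltW a0).
  have q0 : 0 < q^-1 by exact: lt_trans a0 aq.
  have pV0 : 0 < p^-1 by rewrite invr_gt0; lra.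
  have pN0 : p != 0 by rewrite gt_eqF//; lra.
  have qp : q^-1 * p = p - 1.
    by rewrite (_ : q^-1 = 1 - p^-1); [field|lra].
  (* For [p <= 2] the rate is [1/q], with [r p = p - 1] the interpolation exponent; below, [h = 0]
     because [|z|_2 <= |z|_p]. *)
  have [|N x x1|beta b0 Hb] := @gelfand_diag_le R p alpha q^-1 (ltW p_gt1) d1 a0 q0.
  - lra.
  - by rewrite qp; exact: sum_powR_interpolation.
  have [N z N0|gamma g0 Hg] := @kolmogorov_diag_ge R p alpha 0 (ltW p_gt1) d1 a0.
    by rewrite mulr0 powRr0 mul1r; apply: dotp_le_powR_sum => //; lra.
  exists beta, gamma; split=> //; exists (diag_op (ltW p_gt1) d1).
  split; first exact: diag_op_bounded.
  move=> n n0; split; [exact: absolute_width_le_gelfand|exact: Hb|].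
  by have := Hg n n0; rewrite oppr0 add0r.
have d1 k : `|decay alpha k| <= 1 by exact: decay_le1 (ltW a0).
have [||N x x1|beta b0 Hb] :=
  @gelfand_diag_le R p alpha 2^-1 (gt2_ge1 p_gt2) d1 a0.
- by rewrite invr_gt0.
- by rewrite invf_le1// ler1n.
- by rewrite mulrC; exact: sum_powR_le_dotp (ltW p_gt2).
(* For [p > 2] the comparison of [|z|_2] with [|z|_p] costs [N^(1/2 - 1/p)], which is the choice of
   [h]. *)
have [N z N0|gamma g0 Hg] :=
  @kolmogorov_diag_ge R p alpha (2^-1 - p^-1) (gt2_ge1 p_gt2) d1 a0.
  rewrite (_ : 2 * (2^-1 - p^-1) = 1 - 2 / p); last by field; rewrite gt_eqF//; lra.
  exact: dotp_le_powR_sum_dim.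
exists beta, gamma; split=> //; exists (diag_op (gt2_ge1 p_gt2) d1).
split; first exact: diag_op_bounded.
move=> n n0; split; [exact: absolute_width_le_gelfand|exact: Hb|].
by have := Hg n n0; rewrite opprB.
Qed.
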